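(* Consider the problem, the Lagrangian $\mathcal L$ and the NPGA iteration described in the context. Assume: (1) $\mathcal{L}$ has at least one saddle point; (2) the network graph is undirected and connected; (3) for every $i$, $f_i$ is $\mu_i$-strongly convex and $l_i$-smooth with $l_i\ge\mu_i>0$, and $g_i$ and $h$ are proper, convex and lower semicontinuous; put $\mu=\min_i\mu_i$, $l=\max_i l_i$; (4) the symmetric matrices $B,C,D\in\mathbb{R}^{n\times n}$ satisfy: $C=0$ or $\mathrm{Null}(C)=\mathrm{Span}(\mathbf 1_n)$; $\mathrm{Null}(B)=\mathrm{Span}(\mathbf 1_n)$; $0\le C<I$ and $B^2\le I$; $D$ is symmetric doubly stochastic; (5) $g_i=0$ for all $i$ and $A=[A_1,\dots,A_n]$ has full row rank; (6) $\mathrm{Null}(C)=\mathrm{Span}(\mathbf 1_n)$. Let $\mathbf y^0=0$, $\theta\ge 0$, and let the positive step-sizes $\alpha,\beta,\gamma$ satisfy $$\alpha<\frac{1}{l(1+2\theta)},\qquad \beta\le\frac{\mu}{\overline\sigma^2(\mathbf A)\left(\frac{1}{1-\overline\sigma(C)}+\theta\right)},\qquad \gamma<\min\left\{1,\frac{\alpha\beta\,\underline\eta(E)}{\overline\sigma^2(B)}\right\},$$ where $E=\mathbf A\mathbf A^\top+\frac{1}{2\alpha\beta}\mathbf C$. Then $$\delta=\max\left\{1-\alpha\mu\big(1-\alpha l(1+2\theta)\big),\ \frac{1-\alpha\beta\,\underline\eta(E)}{1-\gamma\overline\sigma^2(B)},\ 1-\gamma\underline\sigma^2(B)\right\}$$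 lies in $(0,1)$, and the NPGA iterates satisfy $\|\mathbf x^k-\mathbf x^*\|^2=\mathcal O(\delta^k)$.
   Context: Problem: $n$ agents solve $\min_{x_i\in\mathbb R^{d_i}}\sum_{i=1}^n (f_i(x_i)+g_i(x_i))+h\left(\sum_{i=1}^n A_ix_i\right)$, where $f_i:\mathbb R^{d_i}\to\mathbb R$, $g_i:\mathbb R^{d_i}\to\mathbb R\cup\{+\infty\}$, $h:\mathbb R^p\to\mathbb R\cup\{+\infty\}$, $A_i\in\mathbb R^{p\times d_i}$; the solution set is assumed nonempty. Let $d=\sum_i d_i$, $\mathbf x=[x_1^\top,\dots,x_n^\top]^\top\in\mathbb R^d$, $f(\mathbf x)=\sum_i f_i(x_i)$, $g(\mathbf x)=\sum_i g_i(x_i)$, $A=[A_1,\dots,A_n]\in\mathbb R^{p\times d}$, $\mathbf A=\mathrm{diag}(A_1,\dots,A_n)\in\mathbb R^{np\times d}$ (block diagonal). $h^*$ is the Fenchel conjugate of $h$. The Lagrangian is $\mathcal L(\mathbf x,\lambda)=f(\mathbf x)+g(\mathbf x)+\lambda^\top A\mathbf x-h^*(\lambda)$ for $\lambda\in\mathbb R^p$ (min over $\mathbf x$, max over $\lambda$). ''$l_i$-smooth'' means differentiable with $l_i$-Lipschitz gradient. Notation: for symmetric matrices, $M\le N$ ($M<N$) means $N-M$ is positive semidefinite (positive definite). $\overline\sigma(\cdot)$ and $\underline\sigma(\cdot)$ are the largest and the smallest non-zero singular values; $\underline\eta(\cdot)$ is the smallest non-zero eigenvalue. $\mathbf 1_n$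 is the all-ones vector. $\mathrm{prox}_{\alpha \phi}(x)=\arg\min_y \phi(y)+\frac1{2\alpha}\|y-x\|^2$. The network is a graph on the agents $\{1,\dots,n\}$; $B,C,D\in\mathbb R^{n\times n}$ are symmetric matrices associated with it, $\mathbf B=B\otimes I_p$, $\mathbf C=C\otimes I_p$, $\mathbf D=D\otimes I_p$. For $\boldsymbol\lambda=[\lambda_1^\top,\dots,\lambda_n^\top]^\top\in\mathbb R^{np}$ put $\mathbf h(\boldsymbol\lambda)=\frac1n\sum_{i=1}^n h^*(\lambda_i)$. NPGA: given parameters $\alpha,\beta,\gamma>0$, $\theta\ge0$ and initial points $\mathbf x^0\in\mathbb R^d$, $\boldsymbol\lambda^0\in\mathbb R^{np}$ (arbitrary) and $\mathbf y^0\in\mathbb R^{np}$, for $k\ge0$: $\mathbf x^{k+1}=\mathrm{prox}_{\alpha g}(\mathbf x^k-\alpha(\nabla f(\mathbf x^k)+\mathbf A^\top\boldsymbol\lambda^k))$, $\hat{\mathbf x}^{k+1}=\mathbf x^{k+1}+\theta(\mathbf x^{k+1}-\mathbf x^k)$, $\mathbf v^{k+1}=\boldsymbol\lambda^k-\mathbf C\boldsymbol\lambda^k-\mathbf B\mathbf y^k+\beta\mathbf A\hat{\mathbf x}^{k+1}$, $\mathbf y^{k+1}=\mathbf y^k+\gamma\mathbf B\mathbf v^{k+1}$, $\boldsymbol\lambda^{k+1}=\mathrm{prox}_{\beta\mathbf h}(\mathbf D\mathbf v^{k+1})$. $\mathbf x^*$ denotes the (unique) solution of the problem, i.e. the $\mathbf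 x$-component of the saddle point of $\mathcal L$. *)

(* Defs.v *)
From HB Require Import structures.
From mathcomp Require Import all_boot all_order all_algebra.
From mathcomp Require Import all_classical all_reals all_analysis.

Set Implicit Arguments.
Unset Strict Implicit.
Unset Printing Implicit Defensive.

Import Order.TTheory GRing.Theory Num.Theory.
Import numFieldNormedType.Exports.

Local Open Scope classical_set_scope.
Local Open Scope ring_scope.

(** * Euclidean structure and real-valued functions on R^m *)

Definition dotv (R : realType) (m : nat) (x y : 'cV[R]_m) : R :=
  (x^T *m y) 0 0.

(* The library norm `|x| on matrices is the sup norm.  It defines the same
   topology and the same differentials, but Lipschitz and strong convexity
   moduli, prox and rates refer to the Euclidean norm. *)
Definition enorm (R : realType) (m : nat) (x : 'cV[R]_m) : R :=
  Num.sqrt (dotv x x).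

Definition gradient (R : realType) (m : nat) (f : 'cV[R]_m -> R)
    (x : 'cV[R]_m) : 'cV[R]_m :=
  \col_j 'D_(delta_mx j 0) f x.

Definition smooth (R : realType) (m : nat) (l : R) (f : 'cV[R]_m -> R) : Prop :=
  (forall x, differentiable f x) /\
  (forall x y, enorm (gradient f x - gradient f y) <= l * enorm (x - y)).

Definition strongly_convex (R : realType) (m : nat) (mu : R)
    (f : 'cV[R]_m -> R) : Prop :=
  forall (x y : 'cV[R]_m) (t : R), 0 <= t <= 1 ->
    f (t *: x + (1 - t) *: y) <=
      t * f x + (1 - t) * f y - mu / 2 * t * (1 - t) * enorm (x - y) ^+ 2.

(** * Extended-real-valued functions *)

(* The first clause says that the values lie in R U {+oo}. *)
Definition proper_fun (R : realType) (T : Type) (phi : T -> \bar R) : Prop :=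
  (forall x, (-oo < phi x)%E) /\ (exists x, (phi x < +oo)%E).

(* Only used for functions without the value -oo; the library convention
   0 * +oo = 0 then makes the end points t = 0 and t = 1 trivial. *)
Definition econvex (R : realType) (m : nat) (phi : 'cV[R]_m -> \bar R) : Prop :=
  forall (x y : 'cV[R]_m) (t : R), 0 <= t <= 1 ->
    (phi (t *: x + (1 - t) *: y)%R <= t%:E * phi x + (1 - t)%:E * phi y)%E.

Definition conjugate (R : realType) (m : nat) (phi : 'cV[R]_m -> \bar R)
    (lam : 'cV[R]_m) : \bar R :=
  ereal_sup (range (fun x => ((dotv lam x)%:E - phi x)%E)).

Definition argmin (R : realType) (T : Type) (phi : T -> \bar R) : set T :=
  [set x | forall y, (phi x <= phi y)%E].

(* The set of minimizers; it is a singleton when phi is proper, convex and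
   lower semicontinuous and alpha > 0. *)
Definition prox (R : realType) (m : nat) (alpha : R)
    (phi : 'cV[R]_m -> \bar R) (x : 'cV[R]_m) : set 'cV[R]_m :=
  argmin (fun y => (phi y + ((2 * alpha)^-1 * enorm (y - x) ^+ 2)%:E)%E).

Definition saddle_point (R : realType) (X Y : Type) (L : X -> Y -> \bar R)
    (x : X) (lam : Y) : Prop :=
  (forall lam', (L x lam' <= L x lam)%E) /\ (forall x', (L x lam <= L x' lam)%E).

(** * Matrices *)

Definition nullspace (R : realType) (m n : nat) (M : 'M[R]_(m, n)) :
    set 'cV[R]_n :=
  [set x | M *m x = 0].

Definition span_ones (R : realType) (n : nat) : set 'cV[R]_n :=
  range (fun a : R => a *: const_mx 1).

Arguments span_ones : clear implicits.

Definition psdmx (R : realType) (n : nat) (M : 'M[R]_n) : Prop :=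
  M^T = M /\ forall x : 'cV[R]_n, 0 <= dotv x (M *m x).

Definition pdmx (R : realType) (n : nat) (M : 'M[R]_n) : Prop :=
  M^T = M /\ forall x : 'cV[R]_n, x != 0 -> 0 < dotv x (M *m x).

Definition doubly_stochastic (R : realType) (n : nat) (M : 'M[R]_n) : Prop :=
  [/\ forall i j, 0 <= M i j,
      forall i, \sum_j M i j = 1 &
      forall j, \sum_i M i j = 1].

(* For a wide M this set may contain a spurious 0, which affects neither the
   largest nor the smallest non-zero singular value. *)
Definition singular_values (R : realType) (m n : nat) (M : 'M[R]_(m, n)) :
    set R :=
  [set s | 0 <= s /\ eigenvalue (M^T *m M) (s ^+ 2)].

(* The sets below are finite, so sup and inf are a maximum and a minimum as
   soon as the set is nonempty; on the empty set they are 0. *)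
Definition sigma_max (R : realType) (m n : nat) (M : 'M[R]_(m, n)) : R :=
  sup (singular_values M).

Definition sigma_min (R : realType) (m n : nat) (M : 'M[R]_(m, n)) : R :=
  inf [set s | singular_values M s /\ s <> 0].

Definition eta_min (R : realType) (n : nat) (M : 'M[R]_n) : R :=
  inf [set a | eigenvalue M a /\ a <> 0].

(** * The n-agent problem *)

(* Stacked vectors live in R^(\sum_i d i), with i-th block submxcol x i; in
   particular R^(np) is represented with index type 'I_(\sum_(i < n) p). *)

Definition sum_fun (R : realType) (n : nat) (d : 'I_n -> nat)
    (f : forall i, 'cV[R]_(d i) -> R) (x : 'cV[R]_(\sum_i d i)) : R :=
  \sum_i f i (submxcol x i).

Definition esum_fun (R : realType) (n : nat) (d : 'I_n -> nat)
    (g : forall i, 'cV[R]_(d i) -> \bar R) (x : 'cV[R]_(\sum_i d i)) : \bar R :=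
  (\sum_i g i (submxcol x i))%E.

Definition row_blocks (R : realType) (n p : nat) (d : 'I_n -> nat)
    (A : forall i, 'M[R]_(p, d i)) : 'M[R]_(p, \sum_i d i) :=
  \mxrow_i A i.

(* \mxdiag only covers square diagonal blocks. *)
Definition diag_blocks (R : realType) (n p : nat) (d : 'I_n -> nat)
    (A : forall i, 'M[R]_(p, d i)) : 'M[R]_(\sum_(i < n) p, \sum_i d i) :=
  \mxblock_(i < n, j < n) (if i == j then A j else 0).

(* The Kronecker product of M and the identity of size p, as the block matrix
   with blocks M i j *: 1. *)
Definition kron_id (R : realType) (n p : nat) (M : 'M[R]_n) :
    'M[R]_(\sum_(i < n) p) :=
  \mxblock_(i < n, j < n) ((M i j)%:M : 'M[R]_p).

Definition objective (R : realType) (n p : nat) (d : 'I_n -> nat)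
    (f : forall i, 'cV[R]_(d i) -> R) (g : forall i, 'cV[R]_(d i) -> \bar R)
    (h : 'cV[R]_p -> \bar R) (A : forall i, 'M[R]_(p, d i))
    (x : 'cV[R]_(\sum_i d i)) : \bar R :=
  ((sum_fun f x)%:E + esum_fun g x + h (row_blocks A *m x)%R)%E.

Definition lagrangian (R : realType) (n p : nat) (d : 'I_n -> nat)
    (f : forall i, 'cV[R]_(d i) -> R) (g : forall i, 'cV[R]_(d i) -> \bar R)
    (h : 'cV[R]_p -> \bar R) (A : forall i, 'M[R]_(p, d i))
    (x : 'cV[R]_(\sum_i d i)) (lam : 'cV[R]_p) : \bar R :=
  ((sum_fun f x)%:E + esum_fun g x + (dotv lam (row_blocks A *m x))%:E
   - conjugate h lam)%E.

Definition avg_conjugate (R : realType) (n p : nat) (h : 'cV[R]_p -> \bar R)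
    (lam : 'cV[R]_(\sum_(i < n) p)) : \bar R :=
  ((n%:R^-1)%:E * \sum_(i < n) conjugate h (submxcol lam i))%E.

(* xhat and v are only constrained from index 1 on. *)
Definition npga (R : realType) (n p : nat) (d : 'I_n -> nat)
    (f : forall i, 'cV[R]_(d i) -> R) (g : forall i, 'cV[R]_(d i) -> \bar R)
    (h : 'cV[R]_p -> \bar R) (A : forall i, 'M[R]_(p, d i))
    (B C D : 'M[R]_n) (alpha beta gamma theta : R)
    (x xhat : nat -> 'cV[R]_(\sum_i d i))
    (v y lam : nat -> 'cV[R]_(\sum_(i < n) p)) : Prop :=
  forall k : nat,
  [/\ prox alpha (esum_fun g)
        (x k - alpha *: (gradient (sum_fun f) (x k)
                         + (diag_blocks A)^T *m lam k))
        (x k.+1),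
      xhat k.+1 = x k.+1 + theta *: (x k.+1 - x k),
      v k.+1 = lam k - kron_id p C *m lam k - kron_id p B *m y k
               + beta *: (diag_blocks A *m xhat k.+1),
      y k.+1 = y k + gamma *: (kron_id p B *m v k.+1) &
      prox beta (avg_conjugate h) (kron_id p D *m v k.+1) (lam k.+1)].

(* Main.v *)
Require Import Defs.
From HB Require Import structures.
From mathcomp Require Import all_boot all_order all_algebra.
From mathcomp Require Import all_classical all_reals all_analysis.
From mathcomp Require Import ring lra.

Set Implicit Arguments.
Unset Strict Implicit.
Unset Printing Implicit Defensive.

Import Order.TTheory GRing.Theory Num.Theory.
Import numFieldNormedType.Exports.

Local Open Scope classical_set_scope.
Local Open Scope ring_scope.

(* The smoothness of f and the surjectivity of A give a multiplier ls with
   grad f(xs) + A^T ls = 0 and A xs in the subdifferential of the conjugate of h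
   at ls, so the iteration has a fixed point (xs, ys, 1 (x) ls).  Write
   (X, Y, L) for the error, v for the error of v^{k+1}, and
   w = (I - C) L + beta A (X' + theta (X' - X)), so that v = w - B Y.  The dual
   update satisfies the identity
     |v|^2 - gamma |B v|^2 + |Y'|^2 / gamma
       = |w|^2 + (|Y|^2 - gamma |B Y|^2) / gamma,
   and, with q = alpha beta sigma(A)^2 / (1 - sigma(C)) <= alpha mu and
   kap = 1 - q (1 + theta), the gradient step satisfies
     kap beta/alpha |X'|^2 + |w|^2
       <= delta_1 kap beta/alpha |X|^2 + |L|^2 - alpha beta <L, E L>.
   Since |L'| <= |D v| <= |v|, the Lyapunov function
   kap beta/alpha |X|^2 + (1 - gamma sigma(B)^2) |L|^2 + |Y|^2 / gamma
   contracts by the factor delta. *)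

(** * Inner products *)

Section Dot.
Variables (R : realType) (m : nat).
Implicit Types (x y z : 'cV[R]_m) (a : R).

Lemma dotvE x y : dotv x y = \sum_i x i 0 * y i 0.
Proof. by rewrite /dotv mxE; apply: eq_bigr => i _; rewrite mxE. Qed.

Lemma dotvC x y : dotv x y = dotv y x.
Proof. by rewrite !dotvE; apply: eq_bigr => i _; rewrite mulrC. Qed.

Lemma dotvDl x y z : dotv (x + y) z = dotv x z + dotv y z.
Proof. by rewrite !dotvE -big_split; apply: eq_bigr => i _; rewrite mxE mulrDl. Qed.

Lemma dotvNl x z : dotv (- x) z = - dotv x z.
Proof. by rewrite !dotvE -sumrN; apply: eq_bigr => i _; rewrite mxE mulNr. Qed.

Lemma dotvZl a x z : dotv (a *: x) z = a * dotv x z.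
Proof. by rewrite !dotvE mulr_sumr; apply: eq_bigr => i _; rewrite mxE mulrA. Qed.

Lemma dotv0l z : dotv 0 z = 0.
Proof. by rewrite -(scale0r z) dotvZl mul0r. Qed.

Lemma dotvBl x y z : dotv (x - y) z = dotv x z - dotv y z.
Proof. by rewrite dotvDl dotvNl. Qed.

Lemma dotvDr x y z : dotv z (x + y) = dotv z x + dotv z y.
Proof. by rewrite !(dotvC z) dotvDl. Qed.

Lemma dotvNr x z : dotv z (- x) = - dotv z x.
Proof. by rewrite !(dotvC z) dotvNl. Qed.

Lemma dotvZr a x z : dotv z (a *: x) = a * dotv z x.
Proof. by rewrite !(dotvC z) dotvZl. Qed.

Lemma dotvBr x y z : dotv z (x - y) = dotv z x - dotv z y.
Proof. by rewrite dotvDr dotvNr. Qed.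

Lemma dotv0r z : dotv z 0 = 0.
Proof. by rewrite dotvC dotv0l. Qed.

Definition dotv_lin := (dotvBl, dotvBr, dotvDl, dotvDr, dotvNl, dotvNr, dotvZl, dotvZr).

Lemma dotv_ge0 x : 0 <= dotv x x.
Proof. by rewrite dotvE; apply: sumr_ge0 => i _; rewrite -expr2 sqr_ge0. Qed.

Lemma dotv_eq0 x : dotv x x = 0 -> x = 0.
Proof.
rewrite dotvE => /eqP; rewrite psumr_eq0; last first.
  by move=> i _; rewrite -expr2 sqr_ge0.
move=> /allP x0; apply/colP => i; have := x0 i (mem_index_enum _).
by rewrite -expr2 sqrf_eq0 => /eqP ->; rewrite mxE.
Qed.

Lemma dotv_gt0 x : x != 0 -> 0 < dotv x x.
Proof.
by move=> x0; rewrite lt_def dotv_ge0 andbT; apply: contra x0 => /eqP/dotv_eq0->.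
Qed.

Lemma enorm_sqr x : enorm x ^+ 2 = dotv x x.
Proof. by rewrite sqr_sqrtr ?dotv_ge0. Qed.

Lemma enorm_ge0 x : 0 <= enorm x.
Proof. exact: sqrtr_ge0. Qed.

(** Cauchy-Schwarz: the vector <y, y> x - <x, y> y has squared norm <y, y> (<x, x> <y, y> - <x,
    y>^2). *)
Lemma dotv_sqr_le x y : dotv x y ^+ 2 <= dotv x x * dotv y y.
Proof.
have [->|y0] := eqVneq y 0; first by rewrite !dotv0r mulr0 expr0n.
have yy := dotv_gt0 y0.
have := dotv_ge0 (dotv y y *: x - dotv x y *: y).
rewrite !dotv_lin (dotvC y x) => le0.
suff : 0 <= dotv y y * (dotv x x * dotv y y - dotv x y ^+ 2).
  by rewrite pmulr_rge0 // subr_ge0.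
by apply: le_trans le0 _; rewrite le_eqVlt; apply/orP; left; apply/eqP; ring.
Qed.

End Dot.

Lemma dotv_mulmx (R : realType) (m k : nat) (M : 'M[R]_(m, k)) x y :
  dotv x (M *m y) = dotv (M^T *m x) y.
Proof. by rewrite /dotv trmx_mul trmxK mulmxA. Qed.

Lemma dotv_mulmxl (R : realType) (m k : nat) (M : 'M[R]_(m, k)) x y :
  dotv (M *m x) y = dotv x (M^T *m y).
Proof. by rewrite dotv_mulmx trmxK. Qed.

Lemma dotv_le_enorm (R : realType) (m : nat) (x y : 'cV[R]_m) :
  dotv x y <= enorm x * enorm y.
Proof.
rewrite -sqrtrM ?dotv_ge0 //; apply: le_trans (ler_norm _) _.
by rewrite -sqrtr_sqr ler_wsqrtr // dotv_sqr_le.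
Qed.

(** * Spectral bounds *)

Lemma quad_ge0_lin0 (R : realType) (b c : R) :
  (forall t, 0 <= t * b + t ^+ 2 * c) -> b = 0.
Proof.
move=> H; have [//|b0] := eqVneq b 0.
have b2 : 0 < b ^+ 2 by rewrite exprn_even_gt0.
have [c0|c0] := leP c 0.
  by have := H (- b); have := sqr_ge0 b; nra.
(* The quadratic is minimal at this t, with value -b^2 / (4 c). *)
have := H (- (b / (2 * c))).
have -> : - (b / (2 * c)) * b + (- (b / (2 * c))) ^+ 2 * c = - (b ^+ 2 / (4 * c)).
  by field; rewrite gt_eqF.
by rewrite oppr_ge0 leNgt divr_gt0 // mulr_gt0.
Qed.

Lemma continuous_fsum (R : realType) (T : topologicalType) (I : finType)
    (F : I -> T -> R) :
  (forall i, continuous (F i)) -> continuous (fun x => \sum_i F i x).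
Proof.
move=> Fc x.
have addc : continuous (fun z : R * R => z.1 + z.2) by exact: add_continuous.
by apply: (@cvg_big R I +%R 0 xpredT addc T (nbhs x)) => i _; exact: Fc.
Qed.

(** Row vectors are the form in which [EVT_min_rV] is applied below. *)
Lemma continuous_row_dot (R : realType) (m : nat) (M : 'M[R]_m) :
  continuous (fun u : 'rV[R]_m => (u *m M *m u^T) 0 0 : R).
Proof.
rewrite (_ : (fun _ => _) =
  (fun u : 'rV[R]_m => \sum_i (\sum_j u 0 j * M j i) * u 0 i)); last first.
  by apply/funext => w; rewrite mxE; apply: eq_bigr => i _; rewrite !mxE.
have coordc j (u : 'rV[R]_m) : (fun u : 'rV[R]_m => u 0 j) @ u --> (u 0 j : R).
  exact: coord_continuous.
have inner i : continuous (fun u : 'rV[R]_m => \sum_j u 0 j * M j i : R).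
  by apply: continuous_fsum => j u; exact: (cvgM (coordc j u) (cvg_cst _)).
by apply: continuous_fsum => i u; exact: (cvgM (inner i u) (coordc i u)).
Qed.

(* Courant-Fischer on an invariant subspace, written as the kernel of K: the
   minimiser of the Rayleigh quotient over its unit sphere is an eigenvector. *)
Lemma rayleigh_min (R : realType) (m k : nat) (M : 'M[R]_m) (K : 'M[R]_(k, m))
    (x0 : 'cV[R]_m) :
  M^T = M -> (forall x : 'cV[R]_m, K *m x = 0 -> K *m (M *m x) = 0) ->
  x0 != 0 -> K *m x0 = 0 ->
  exists (a : R) (x : 'cV[R]_m), [/\ x != 0, K *m x = 0, M *m x = a *: x &
    forall y : 'cV[R]_m, K *m y = 0 -> a * dotv y y <= dotv y (M *m y)].
Proof.
move=> Msym KM x0N0 Kx0.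
(* The unit sphere of the kernel of [K]. Writing the norm as the quadratic form of [1%:M] lets one
   continuity lemma serve both constraint and objective. *)
pose S := [set u : 'rV[R]_m | u *m K^T = 0 /\ (u *m 1%:M *m u^T) 0 0 = 1].
have rowE (N : 'M[R]_m) (u : 'rV[R]_m) : (u *m N *m u^T) 0 0 = dotv u^T (N *m u^T).
  by rewrite /dotv trmxK mulmxA.
have KE (u : 'rV[R]_m) : (u *m K^T = 0) <-> (K *m u^T = 0).
  split=> [H|H]; apply: trmx_inj; rewrite trmx_mul ?trmxK ?H ?trmx0 //.
have S0 : S !=set0.
  exists ((enorm x0)^-1 *: x0^T); split.
    by apply/KE; rewrite linearZ /= trmxK -scalemxAr Kx0 scaler0.
  rewrite rowE mul1mx linearZ /= trmxK !dotv_lin -enorm_sqr expr2.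
  have : enorm x0 != 0.
    by apply: contra x0N0 => /eqP e0; apply/eqP/dotv_eq0; rewrite -enorm_sqr e0 expr0n.
  by move=> e0; field.
have Scl : closed S.
  (* The linear constraint becomes the zero set of |K u^T|^2, again a quadratic form. *)
  have -> : S = (fun u : 'rV[R]_m => (u *m (K^T *m K) *m u^T) 0 0) @^-1` [set 0]
     `&` (fun u : 'rV[R]_m => (u *m 1%:M *m u^T) 0 0) @^-1` [set 1].
    apply/seteqP; split=> u /= [H1 H2]; split=> //.
      by rewrite mulmxA H1 !mul0mx mxE.
    move: H1; rewrite rowE -mulmxA -dotv_mulmxl => /dotv_eq0 H.
    by apply/KE.
  by apply: closedI; apply: closed_comp => //;
    by [move=> u _; exact: continuous_row_dot | exact: closed_eq].
have Sb : bounded_set S.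
  exists 1; split=> // M1 M1g u [_]; rewrite rowE mul1mx dotvE => u1.
  apply: le_trans (ltW M1g); rewrite [leLHS]/Num.norm /= mx_normrE.
  apply/bigmax_leP; split=> //= -[i j] _ /=; rewrite (ord1 i).
  rewrite -(@ler_pXn2r _ 2) ?nnegrE // expr1n -normrX ger0_norm ?sqr_ge0 // -u1.
  rewrite (bigD1 j) //= mxE -expr2 lerDl.
  by apply: sumr_ge0 => l _; rewrite -expr2 sqr_ge0.
have [u] := EVT_min_rV S0 (bounded_closed_compact Sb Scl)
  (continuous_subspaceT (@continuous_row_dot _ _ M)).
rewrite inE => -[Ku u1] umin.
set x := u^T; have Kx : K *m x = 0 by apply/KE.
have x1 : dotv x x = 1 by move: u1; rewrite rowE mul1mx.
pose a := dotv x (M *m x).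
have amin y : K *m y = 0 -> a * dotv y y <= dotv y (M *m y).
  move=> Ky; have [->|y0] := eqVneq y 0.
    by rewrite dotv0l mulr0 dotv0l.
  have e0 : 0 < enorm y by rewrite sqrtr_gt0 dotv_gt0.
  have := umin ((enorm y)^-1 *: y^T); rewrite inE !rowE linearZ /= trmxK => /(_ _)/wrap[].
    split; first by apply/KE; rewrite linearZ /= trmxK -scalemxAr Ky scaler0.
    by rewrite rowE mul1mx linearZ /= trmxK !dotv_lin -enorm_sqr; field; rewrite gt_eqF.
  rewrite -scalemxAr !dotv_lin -/x -/a => H.
  rewrite -enorm_sqr -ler_pdivlMr ?exprn_gt0 //.
  by apply: le_trans H _; rewrite le_eqVlt; apply/orP; left; apply/eqP; field; rewrite gt_eqF.
exists a, x; split => //.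
  by apply: contra_eq_neq x1 => ->; rewrite dotv0l eq_sym oner_eq0.
(* The residual z = M x - a x lies in the kernel of [K]. The Rayleigh inequality at x + t z reads 0
   <= 2 t <z, z> + O(t^2) for every real t, which forces z = 0. *)
apply/eqP; rewrite -subr_eq0; apply/eqP; set z := _ - _.
have Kz : K *m z = 0 by rewrite mulmxBr KM // -scalemxAr Kx scaler0 subr0.
have Mx : M *m x = z + a *: x by rewrite subrK.
clearbody z; apply: dotv_eq0.
have : 2 * dotv z z = 0; last by lra.
apply: (@quad_ge0_lin0 _ _ (dotv z (M *m z) - a * dotv z z)) => t.
have := amin (x + t *: z); rewrite mulmxDr -scalemxAr Kx Kz scaler0 addr0 => /(_ erefl).
rewrite mulmxDr -scalemxAr !dotv_lin (dotvC z x) [dotv x (M *m z)]dotv_mulmx Msym.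
rewrite -/a x1 (dotvC _ z).
rewrite Mx !dotv_lin (dotvC z x) => H; rewrite -subr_ge0 in H.
by apply: le_trans H _; rewrite le_eqVlt; apply/orP; left; apply/eqP; ring.
Qed.

(** * Extreme singular values and eigenvalues as bounds on quadratic forms *)

Section SingularValues.
Variable R : realType.

(** [eigenvalue] speaks of row eigenvectors; symmetry allows transposing them into columns. *)
Lemma eigenvalue_symP m (M : 'M[R]_m) (a : R) : M^T = M ->
  eigenvalue M a <-> exists2 x : 'cV[R]_m, M *m x = a *: x & x != 0.
Proof.
move=> Msym; split=> [/eigenvalueP[u uM u0]|[x Mx x0]].
  exists u^T; last by rewrite -trmx0 (inj_eq (@trmx_inj _ _ _)).
  by rewrite -{1}Msym -trmx_mul uM linearZ.
apply/eigenvalueP; exists x^T; last by rewrite -trmx0 (inj_eq (@trmx_inj _ _ _)).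
by rewrite -{1}Msym -trmx_mul Mx linearZ.
Qed.

Lemma gram_sym m k (M : 'M[R]_(m, k)) : (M^T *m M)^T = M^T *m M.
Proof. by rewrite trmx_mul trmxK. Qed.

Lemma dotv_gram m k (M : 'M[R]_(m, k)) x : dotv x (M^T *m M *m x) = dotv (M *m x) (M *m x).
Proof. by rewrite -mulmxA dotv_mulmx trmxK. Qed.

Lemma singular_valuesP m k (M : 'M[R]_(m, k)) s : singular_values M s ->
  exists x : 'cV[R]_k,
    [/\ x != 0, M^T *m M *m x = s ^+ 2 *: x & dotv (M *m x) (M *m x) = s ^+ 2 * dotv x x].
Proof.
move=> [_ /(eigenvalue_symP _ (gram_sym M))[x Mx x0]]; exists x; split=> //.
by rewrite -dotv_gram Mx dotv_lin.
Qed.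

(** The largest eigenvalue of M^T M is minus the Rayleigh minimum of - M^T M. The constraint matrix
    has no rows, so the whole space is admissible. *)
Lemma sigma_maxP m k (M : 'M[R]_(m, k)) : (0 < k)%N ->
  singular_values M (sigma_max M) /\
  forall y, dotv (M *m y) (M *m y) <= sigma_max M ^+ 2 * dotv y y.
Proof.
move=> k0; pose e : 'cV[R]_k := const_mx 1.
have e0 : e != 0.
  by apply/eqP => /matrixP/(_ (Ordinal k0) 0); rewrite !mxE => /eqP; rewrite oner_eq0.
have [||||a [x [x0 _ Mx amin]]] := @rayleigh_min R k 0 (- (M^T *m M)) 0 e.
- by rewrite linearN /= gram_sym.
- by move=> *; rewrite mul0mx.
- exact: e0.
- by rewrite mul0mx.
have {}amin y : dotv (M *m y) (M *m y) <= - a * dotv y y.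
  have := amin y; rewrite mul0mx => /(_ erefl).
  by rewrite mulNmx dotvNr dotv_gram mulNr lerNr.
have Mxx : M^T *m M *m x = - a *: x by rewrite scaleNr -Mx mulNmx opprK.
have a0 : 0 <= - a.
  have := dotv_ge0 (M *m x); rewrite -dotv_gram Mxx dotv_lin.
  by rewrite pmulr_lge0 // dotv_gt0.
have sa : singular_values M (Num.sqrt (- a)).
  split; first exact: sqrtr_ge0.
  by apply/(eigenvalue_symP _ (gram_sym M)); exists x => //; rewrite sqr_sqrtr.
have ub s : singular_values M s -> s <= Num.sqrt (- a).
  move=> ss; have [z [z0 _ Mz]] := singular_valuesP ss; have [s0 _] := ss.
  rewrite -(@ler_pXn2r _ 2) ?nnegrE ?sqrtr_ge0 // sqr_sqrtr //.
  by have := amin z; rewrite Mz ler_pM2r ?dotv_gt0.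
suff -> : sigma_max M = Num.sqrt (- a) by split=> // y; rewrite sqr_sqrtr.
apply/eqP; rewrite eq_le; apply/andP; split.
  by apply: ge_sup; [exists (Num.sqrt (- a))|exact: ub].
by apply: ub_le_sup => //; exists (Num.sqrt (- a)).
Qed.

Lemma sigma_max_bound m k (M : 'M[R]_(m, k)) y :
  dotv (M *m y) (M *m y) <= sigma_max M ^+ 2 * dotv y y.
Proof.
case: k M y => [|k] M y; last by case: (sigma_maxP M (ltn0Sn k)).
by rewrite (_ : y = 0) ?mulmx0 ?dotv0l ?mulr0 //; apply/colP => -[].
Qed.

Lemma sigma_max_le1 m k (M : 'M[R]_(m, k)) : (0 < k)%N ->
  psdmx (1%:M - M^T *m M) -> sigma_max M ^+ 2 <= 1.
Proof.
move=> k0 [_ H]; have [/singular_valuesP[x [x0 _ Mx]] _] := sigma_maxP M k0.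
have := H x; rewrite mulmxBl mul1mx dotvBr dotv_gram Mx subr_ge0.
by rewrite ger_pMl // dotv_gt0.
Qed.

(** A singular vector x satisfies (C - s I)(C + s I) x = 0. Either C x + s x is an eigenvector of C
    for s, and I - C > 0 gives s < 1, or C x = - s x, and C >= 0 gives s <= 0. *)
Lemma sigma_max_lt1 k (C : 'M[R]_k) : (0 < k)%N ->
  psdmx C -> pdmx (1%:M - C) -> 0 <= sigma_max C < 1.
Proof.
move=> k0 [Csym Cpsd] [_ Cpd].
have [sC _] := sigma_maxP C k0; set s := sigma_max C in sC *.
have [x [x0 Cx _]] := singular_valuesP sC; have [s0 _] := sC; rewrite s0 /=.
have Cw (w : 'cV[R]_k) : w != 0 -> C *m w = s *: w -> s < 1.
  move=> w0 Cw; have := Cpd w w0; rewrite mulmxBl mul1mx Cw !dotv_lin.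
  by rewrite subr_gt0 gtr_pMl // dotv_gt0.
have [Csx|Csx] := eqVneq (C *m x + s *: x) 0; last first.
  apply: (Cw _ Csx); rewrite mulmxDr mulmxA -{1}Csym Cx -scalemxAr scalerDr scalerA.
  by rewrite addrC expr2.
have {}Csx : C *m x = - s *: x by rewrite scaleNr; apply/eqP; rewrite -addr_eq0 Csx.
have := Cpsd x; rewrite Csx dotv_lin pmulr_lge0 ?dotv_gt0 // => sN.
by apply: le_lt_trans ltr01; rewrite -oppr_ge0.
Qed.

(** Positivity of C at v - t C v replaces a diagonalisation of C. The bound feeds [mixing_bound] and
    shows that <v, C v> = 0 forces C v = 0. *)
Lemma psd_sqr_le k (C : 'M[R]_k) v : psdmx C ->
  dotv (C *m v) (C *m v) <= sigma_max C * dotv v (C *m v).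
Proof.
move=> [Csym Cpsd]; case: (posnP k) => [k0|k0].
  have -> : v = 0 by subst k; apply/colP => -[].
  by rewrite mulmx0 !dotv0l mulr0.
have s0 : 0 <= sigma_max C by have [[]] := sigma_maxP C k0.
set s := sigma_max C in s0 *; set w := C *m v.
have [w0|w0] := eqVneq w 0; first by rewrite w0 !dotv0r mulr0.
have ww := dotv_gt0 w0.
have Cw : dotv w (C *m w) <= s * dotv w w.
  apply: le_trans (dotv_le_enorm _ _) _.
  have : enorm (C *m w) <= s * enorm w.
    rewrite -(@ler_pXn2r _ 2) ?nnegrE ?mulr_ge0 ?enorm_ge0 //.
    by rewrite exprMn !enorm_sqr sigma_max_bound.
  move=> /(ler_wpM2l (enorm_ge0 w)) /le_trans; apply.
  by rewrite -enorm_sqr mulrCA expr2.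
have [s00|s_gt0] : s = 0 \/ 0 < s by move: s0; rewrite le_eqVlt => /orP[/eqP|]; auto.
  have := sigma_max_bound C v; rewrite -/s s00 expr0n mul0r -/w => H.
  by rewrite mul0r.
(* expand 0 <= <v - t w, C (v - t w)> at the optimal t = 1/s *)
have := Cpsd (v - s^-1 *: w).
rewrite mulmxBr -scalemxAr -/w !dotv_lin.
have -> : dotv v (C *m w) = dotv w w by rewrite dotv_mulmx Csym.
move=> H; have sv : s^-1 * (s^-1 * dotv w (C *m w)) <= s^-1 * dotv w w.
  by rewrite ler_pM2l ?invr_gt0 // ler_pdivrMl.
rewrite -ler_pdivrMl //; lra.
Qed.

(** The two hypotheses on [K] make its kernel the range of M^T, that is, the orthogonal complement
    of the kernel of M. The Rayleigh minimum of M^T M there is its smallest non-zero eigenvalue. The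
    vector [x0] ensures that such an eigenvalue exists, since the infimum of the empty set is 0. *)
Lemma sigma_minP m k (M : 'M[R]_m) (K : 'M[R]_(k, m)) (x0 : 'cV[R]_m) :
  K *m M^T = 0 -> (forall y : 'cV[R]_m, K *m y = 0 -> M *m y = 0 -> y = 0) ->
  x0 != 0 -> K *m x0 = 0 ->
  0 < sigma_min M /\
  forall y : 'cV[R]_m, K *m y = 0 -> sigma_min M ^+ 2 * dotv y y <= dotv (M *m y) (M *m y).
Proof.
move=> KM Kinj x0N0 Kx0.
have [||||a [x [xN0 Kx Mx amin]]] := @rayleigh_min R m k (M^T *m M) K x0.
- exact: gram_sym.
- by move=> z _; rewrite !mulmxA KM !mul0mx.
- exact: x0N0.
- exact: Kx0.
have xx := dotv_gt0 xN0.
have a0 : 0 < a.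
  have : 0 < dotv (M *m x) (M *m x).
    by apply/dotv_gt0/eqP => /(Kinj _ Kx) /eqP; apply/negP.
  by rewrite -dotv_gram Mx dotv_lin pmulr_lgt0.
have {}amin y : K *m y = 0 -> a * dotv y y <= dotv (M *m y) (M *m y).
  by move=> /amin; rewrite dotv_gram.
have s0 : 0 < Num.sqrt a by rewrite sqrtr_gt0.
have sa : singular_values M (Num.sqrt a) /\ Num.sqrt a <> 0.
  split; last by apply/eqP; rewrite gt_eqF.
  split; first exact: sqrtr_ge0.
  apply/(eigenvalue_symP _ (gram_sym M)); exists x => //.
  by rewrite sqr_sqrtr ?(ltW a0).
have lb s : singular_values M s /\ s <> 0 -> Num.sqrt a <= s.
  move=> [ss /eqP sN0]; have [z [zN0 Mz Mzz]] := singular_valuesP ss; have [sge0 _] := ss.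
  (* Eigenvectors for a non-zero eigenvalue lie in the range of M^T, hence in the kernel of [K]. *)
  have Kz : K *m z = 0.
    have /eqP : s ^+ 2 *: (K *m z) = 0 by rewrite scalemxAr -Mz !mulmxA KM !mul0mx.
    by rewrite scaler_eq0 sqrf_eq0 (negbTE sN0) => /eqP.
  rewrite -(@ler_pXn2r _ 2) ?nnegrE ?sqrtr_ge0 // sqr_sqrtr ?(ltW a0) //.
  by have := amin z Kz; rewrite Mzz ler_pM2r ?dotv_gt0.
suff -> : sigma_min M = Num.sqrt a by split=> // y; rewrite sqr_sqrtr ?(ltW a0) //; exact: amin.
apply/eqP; rewrite eq_le; apply/andP; split.
  by apply: ge_inf => //; exists (Num.sqrt a).
by apply: lb_le_inf; [exists (Num.sqrt a)|exact: lb].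
Qed.

(** Positive definiteness excludes the eigenvalue 0, so the smallest non-zero eigenvalue is the
    global Rayleigh minimum. *)
Lemma eta_min_le m (E : 'M[R]_m) y : pdmx E -> eta_min E * dotv y y <= dotv y (E *m y).
Proof.
move=> [Esym Epd]; have [->|y0] := eqVneq y 0; first by rewrite !dotv0l mulr0.
have [||||a [x [x0 _ Ex amin]]] := @rayleigh_min R m 0 E 0 y.
- exact: Esym.
- by move=> *; rewrite mul0mx.
- exact: y0.
- by rewrite mul0mx.
have {}amin z : a * dotv z z <= dotv z (E *m z) by apply: amin; rewrite mul0mx.
have a0 : 0 < a by have := Epd x x0; rewrite Ex dotv_lin pmulr_lgt0 ?dotv_gt0.
apply: le_trans (amin y); rewrite ler_pM2r ?dotv_gt0 //; apply: ge_inf.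
  exists a => b [/(eigenvalue_symP _ Esym)[z Ez z0] _].
  by have := amin z; rewrite Ez dotv_lin ler_pM2r ?dotv_gt0.
split; last by apply/eqP; rewrite gt_eqF.
by apply/(eigenvalue_symP _ Esym); exists x.
Qed.

End SingularValues.

(** * Smooth and strongly convex functions *)

Lemma derive_gradient (R : realType) m (f : 'cV[R]_m -> R) (x v : 'cV[R]_m) :
  differentiable f x -> 'D_v f x = dotv (gradient f x) v.
Proof.
move=> fx; rewrite deriveE // dotvE.
have {1}-> : v = \sum_i v i 0 *: delta_mx i 0.
  by rewrite [LHS]matrix_sum_delta; apply: eq_bigr => i _; rewrite big_ord1.
rewrite linear_sum; apply: eq_bigr => i _.
by rewrite linearZ /= mxE deriveE // mulrC.
Qed.

Lemma is_derive_line (R : realType) m (f : 'cV[R]_m -> R) (x d : 'cV[R]_m) (t : R) :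
  differentiable f (x + t *: d) ->
  is_derive t 1 (fun t => f (x + t *: d)) (dotv (gradient f (x + t *: d)) d).
Proof.
move=> fd; rewrite -derive_gradient //.
have E : (fun h : R => h^-1 *: (f (x + (h *: 1 + t) *: d) - f (x + t *: d))) =
         (fun h : R => h^-1 *: (f (h *: d + (x + t *: d)) - f (x + t *: d))).
  apply/funext => h; congr (_ *: (f _ - _)).
  by rewrite scalerDl addrCA [h *: 1]mulr1.
have fdd : derivable f (x + t *: d) d by exact: diff_derivable.
by apply: DeriveDef; rewrite /derivable /derive /= E.
Qed.

Section Smooth.
Variables (R : realType) (m : nat) (f : 'cV[R]_m -> R) (l : R).
Hypothesis fl : smooth l f.

(** The descent lemma for f (s = 1) and for -f (s = -1) at once. The mean value theorem applies to
    [psi], whose derivative is non-positive on [0, 1] by Cauchy-Schwarz and the Lipschitz bound. *)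
Lemma smooth_quad_sign (x d : 'cV[R]_m) (s : R) : `|s| = 1 ->
  s * (f (x + d) - f x - dotv (gradient f x) d) <= l / 2 * dotv d d.
Proof.
move=> s1; have [fdiff flip] := fl.
pose psi := fun t : R => s * (f (x + t *: d) - t * dotv (gradient f x) d)
  - t ^+ 2 * (l / 2 * dotv d d).
pose dpsi := fun t : R => s * (dotv (gradient f (x + t *: d)) d - dotv (gradient f x) d)
  - t * (l * dotv d d).
have psid (t : R) : is_derive t 1 psi (dpsi t).
  have H := is_derive_line (fdiff (x + t *: d)).
  apply: is_derive_eq; rewrite /dpsi /GRing.scale /=.
  by field.
have psic : {within `[0, 1], continuous psi}.
  apply: continuous_subspaceT => t.
  by apply/differentiable_continuous/derivable1_diffP; have [] := psid t.
have [c] := MVT ltr01 (fun t _ => psid t) psic.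
rewrite in_itv /= => /andP[c0 c1]; rewrite subr0 mulr1 => E.
have : psi 1 - psi 0 <= 0.
  rewrite E /dpsi subr_le0; apply: le_trans (ler_norm _) _.
  rewrite normrM s1 mul1r -dotvBl.
  have le1 := flip (x + c *: d) x.
  rewrite addrAC subrr add0r in le1.
  have nd : enorm (c *: d) = c * enorm d.
    by rewrite /enorm !dotv_lin mulrA sqrtrM ?sqr_ge0 // -expr2 sqrtr_sqr gtr0_norm.
  have : `|dotv (gradient f (x + c *: d) - gradient f x) d| <=
         enorm (gradient f (x + c *: d) - gradient f x) * enorm d.
    rewrite ler_norml dotv_le_enorm andbT lerNl -dotvNl.
    apply: le_trans (dotv_le_enorm _ _) _.
    by rewrite {1}/enorm dotvNl dotvNr opprK.
  move=> /le_trans; apply; rewrite -enorm_sqr expr2.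
  have -> : c * (l * (enorm d * enorm d)) = l * enorm (c *: d) * enorm d.
    by rewrite nd; ring.
  by rewrite ler_wpM2r ?enorm_ge0.
rewrite /psi scale1r scale0r addr0; lra.
Qed.

Lemma smooth_upper (x d : 'cV[R]_m) :
  f (x + d) <= f x + dotv (gradient f x) d + l / 2 * dotv d d.
Proof. by have := smooth_quad_sign x d (normr1 _); lra. Qed.

Lemma smooth_lower (x d : 'cV[R]_m) :
  f x + dotv (gradient f x) d - l / 2 * dotv d d <= f (x + d).
Proof. by have := smooth_quad_sign x d (normrN1 _); lra. Qed.

End Smooth.

(* A quadratic error bound stands in for the limit t -> 0 in first-order
   conditions. *)
Lemma le_of_quadratic_error (R : realType) (a b c : R) :
  (forall t, 0 < t <= 1 -> t * a <= t * b + t ^+ 2 * c) -> a <= b.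
Proof.
move=> H; rewrite leNgt; apply/negP => ba.
(* With this t the error t c is at most half of the supposed gap a - b. *)
have /andP[t0 t1] : 0 < Num.min 1 ((a - b) / (2 * (`|c| + 1))) <= 1.
  rewrite lt_min ltr01 /= ge_min lexx /= andbT.
  by rewrite divr_gt0 ?subr_gt0 // mulr_gt0 // ltr_wpDl.
have := H _ (introT andP (conj t0 t1)).
move: t0; set t := Num.min _ _ => t0.
rewrite expr2 -mulrA -mulrDr ler_pM2l // => ab.
have tle : t * (2 * (`|c| + 1)) <= a - b.
  by rewrite -ler_pdivlMr ?ge_min ?lexx ?orbT // mulr_gt0 // ltr_wpDl.
have : t * c <= t * `|c| by rewrite ler_pM2l // ler_norm.
have : 0 <= `|c| by [].
nra.
Qed.

Section StronglyConvex.
Variables (R : realType) (m : nat) (f : 'cV[R]_m -> R) (l mu : R).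
Hypotheses (fl : smooth l f) (fmu : strongly_convex mu f).

(** At x + t (y - x), the strong convexity bound from above meets [smooth_lower] from below;
    together they give the claim times t, up to an error of order t^2. *)
Lemma strongly_convex_first_order (x y : 'cV[R]_m) :
  f x + dotv (gradient f x) (y - x) + mu / 2 * dotv (y - x) (y - x) <= f y.
Proof.
set d := y - x; set g := dotv _ d; set D := dotv d d.
suff : g + mu / 2 * D <= f y - f x by lra.
apply: (@le_of_quadratic_error _ _ _ (mu / 2 * D + l / 2 * D)) => t /andP[t0 t1].
have := fmu y x (t := t); rewrite (ltW t0) t1 enorm_sqr => /(_ erefl).
have -> : t *: y + (1 - t) *: x = x + t *: d.
  by rewrite /d scalerBr scalerBl scale1r addrCA addrA addrC addrA.
have := smooth_lower fl x (t *: d); rewrite !(dotvZl, dotvZr) -/d -/g -/D.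
lra.
Qed.

Lemma gradient_strongly_monotone (x y : 'cV[R]_m) :
  mu * dotv (x - y) (x - y) <= dotv (gradient f x - gradient f y) (x - y).
Proof.
have := strongly_convex_first_order x y; have := strongly_convex_first_order y x.
rewrite -(opprB x y) !(dotvNl, dotvNr) opprK (dotvBl (gradient f x)); lra.
Qed.

(* Baillon-Haddad: compare f at x and at the gradient step taken from y. *)
Lemma gradient_cocoercive (x y : 'cV[R]_m) : 0 <= mu -> 0 < l ->
  dotv (gradient f x - gradient f y) (gradient f x - gradient f y) <=
  l * dotv (gradient f x - gradient f y) (x - y).
Proof.
move=> mu0 l0.
(* The point w - G / l minimises the quadratic upper model at w of f minus its linear part at u.
   Adding this inequality to its copy with u and w exchanged gives the claim. *)
have step (u w : 'cV[R]_m) : f u + dotv (gradient f u) (w - u)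
   + (2 * l)^-1 * dotv (gradient f w - gradient f u) (gradient f w - gradient f u) <= f w.
  set G := gradient f w - gradient f u.
  have gw : gradient f w = gradient f u + G by rewrite addrC subrK.
  have := strongly_convex_first_order u (w - l^-1 *: G).
  have := smooth_upper fl w (- (l^-1 *: G)).
  rewrite {1}gw; clearbody G.
  have -> : w - l^-1 *: G - u = (w - u) - l^-1 *: G by rewrite addrAC.
  rewrite (dotvDl (gradient f u)) !(dotvNr, dotvNl) opprK.
  rewrite (dotvBr (w - u) (l^-1 *: G) (gradient f u)) !(dotvZr, dotvZl).
  have := mulr_ge0 (divr_ge0 mu0 (ler0n _ 2)) (dotv_ge0 (w - u - l^-1 *: G)).
  have -> : l / 2 * (l^-1 * (l^-1 * dotv G G)) = (2 * l)^-1 * dotv G G.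
    by field; rewrite gt_eqF.
  have -> : l^-1 * dotv G G = 2 * ((2 * l)^-1 * dotv G G).
    by field; rewrite gt_eqF.
  lra.
have := step x y; have := step y x; rewrite -(opprB x y) -(opprB (gradient f x)).
rewrite !(dotvNl, dotvNr) opprK (dotvBl (gradient f x) _ (x - y)).
rewrite -ler_pdivrMl // => H1 H2.
have -> : l^-1 * dotv (gradient f x - gradient f y) (gradient f x - gradient f y)
  = 2 * ((2 * l)^-1 * dotv (gradient f x - gradient f y) (gradient f x - gradient f y)).
  by field; rewrite gt_eqF.
lra.
Qed.

End StronglyConvex.

(** * Stacked vectors *)

Section Stack.
Variables (R : realType) (n : nat) (d : 'I_n -> nat).
Implicit Types x y : 'cV[R]_(\sum_i d i).

Lemma submxcolZ (a : R) x i : submxcol (a *: x) i = a *: submxcol x i.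
Proof. by apply/matrixP => j k; rewrite !mxE. Qed.

Lemma dotv_submxcol x y : dotv x y = \sum_i dotv (submxcol x i) (submxcol y i).
Proof.
rewrite /dotv -{1}(submxcolK x) -{1}(submxcolK y) tr_mxcol mul_mxrow_mxcol.
by rewrite summxE.
Qed.

Lemma submxcol_inj x y : (forall i, submxcol x i = submxcol y i) -> x = y.
Proof. by move=> xy; rewrite -(submxcolK x) -(submxcolK y); apply: eq_mxcol. Qed.

(** Along a direction v, the k-th summand varies only through the k-th block of v, so the
    directional derivative splits over the blocks exactly as the inner product does. *)
Lemma gradient_sum_fun (f : forall i, 'cV[R]_(d i) -> R) x i :
  (forall i z, differentiable (f i) z) ->
  submxcol (gradient (sum_fun f) x) i = gradient (f i) (submxcol x i).
Proof.
move=> fd; pose g x := \mxcol_i gradient (f i) (submxcol x i).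
rewrite -[RHS](mxcolK (fun i => gradient (f i) (submxcol x i)) i) -/(g x).
congr (submxcol _ i); apply/colP => j; rewrite mxE.
set v := delta_mx j 0.
have quotient k : (fun h : R => h^-1 *: (f k (submxcol (h *: v + x) k) - f k (submxcol x k)))
  = (fun h : R => h^-1 *: (f k (h *: submxcol v k + submxcol x k) - f k (submxcol x k))).
  by apply/funext => h; rewrite submxcolD submxcolZ.
have derk k : is_derive x v (fun x => f k (submxcol x k))
                            (dotv (gradient (f k) (submxcol x k)) (submxcol v k)).
  have fkd : derivable (f k) (submxcol x k) (submxcol v k) by exact: diff_derivable.
  rewrite -(derive_gradient (submxcol v k) (fd k (submxcol x k))).
  by apply: DeriveDef; rewrite /derivable /derive /= quotient.
have -> : sum_fun f = \sum_(k < n) (fun x => f k (submxcol x k)).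
  by apply/funext => z; rewrite fct_sumE.
have [_ ->] := is_derive_sum derk.
have -> : g x j 0 = dotv (g x) v.
  rewrite dotvE (bigD1 j) //= [X in _ + X]big1 => [|k /negbTE kj].
    by rewrite addr0 [v j 0]mxE !eqxx mulr1.
  by rewrite [v k 0]mxE kj mulr0.
by rewrite dotv_submxcol; apply: eq_bigr => k _; rewrite mxcolK.
Qed.

Variable p : nat.
Implicit Types A : forall i, 'M[R]_(p, d i).

Lemma submxcol_diag_blocks A x i :
  submxcol (diag_blocks A *m x) i = A i *m submxcol x i.
Proof.
rewrite -{1}(submxcolK x) mul_mxblock_mxrow mxcolK (bigD1 i) //= eqxx big1 ?addr0 //.
by move=> j /negbTE; rewrite eq_sym => ->; rewrite mul0mx.
Qed.

Lemma submxcol_diag_blocksT A (v : 'cV[R]_(\sum_(i < n) p)) i :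
  submxcol ((diag_blocks A)^T *m v) i = (A i)^T *m submxcol v i.
Proof.
rewrite -{1}(submxcolK v) tr_mxblock mul_mxblock_mxrow mxcolK.
rewrite (bigD1 i) //= eqxx big1 ?addr0 //.
by move=> j /negbTE ->; rewrite trmx0 mul0mx.
Qed.

Lemma row_blocks_mul A x : row_blocks A *m x = \sum_i A i *m submxcol x i.
Proof. by rewrite -{1}(submxcolK x) mul_mxrow_mxcol. Qed.

Lemma submxcol_row_blocksT A (w : 'cV[R]_p) i :
  submxcol ((row_blocks A)^T *m w) i = (A i)^T *m w.
Proof. by rewrite tr_mxrow mxcol_mul mxcolK. Qed.

End Stack.

(** * Kronecker products with the identity, reduced to slices *)

Section Kron.
Variables (R : realType) (n p : nat).
Implicit Types (M : 'M[R]_n) (u v : 'cV[R]_(\sum_(i < n) p)).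

(* Coordinate q of every block: kron_id p M acts as M on each slice. *)
Definition slice (q : 'I_p) v : 'cV[R]_n := \col_i (submxcol v i) q 0.

Definition stack (w : 'cV[R]_p) : 'cV[R]_(\sum_(i < n) p) := \mxcol_(i < n) w.

Lemma submxcol_stack w i : submxcol (stack w) i = w.
Proof. by rewrite /stack (mxcolK (fun=> w)). Qed.

Lemma submxcol_kron M v i :
  submxcol (kron_id p M *m v) i = \sum_j M i j *: submxcol v j.
Proof.
rewrite -{1}(submxcolK v) mul_mxblock_mxrow mxcolK.
by apply: eq_bigr => j _; rewrite mul_scalar_mx.
Qed.

Lemma slice_kron M v q : slice q (kron_id p M *m v) = M *m slice q v.
Proof.
apply/colP => i; rewrite mxE submxcol_kron summxE mxE.
by apply: eq_bigr => j _; rewrite [LHS]mxE [in RHS]mxE.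
Qed.

Lemma slice_inj u v : (forall q, slice q u = slice q v) -> u = v.
Proof.
move=> uv; apply: submxcol_inj => i; apply/colP => q.
by have /colP/(_ i) := uv q; rewrite !mxE.
Qed.

Lemma sliceD u v q : slice q (u + v) = slice q u + slice q v.
Proof. by apply/colP => i; rewrite !mxE. Qed.

Lemma sliceB u v q : slice q (u - v) = slice q u - slice q v.
Proof. by apply/colP => i; rewrite !mxE. Qed.

Lemma sliceZ (a : R) v q : slice q (a *: v) = a *: slice q v.
Proof. by apply/colP => i; rewrite !mxE. Qed.

Lemma slice0 q : slice q 0 = 0.
Proof. by apply/colP => i; rewrite !mxE. Qed.

Lemma slice_stack w q : slice q (stack w) = w q 0 *: const_mx 1.
Proof. by apply/colP => i; rewrite mxE submxcol_stack !mxE mulr1. Qed.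

Lemma dotv_slice u v : dotv u v = \sum_q dotv (slice q u) (slice q v).
Proof.
rewrite dotv_submxcol; under [RHS]eq_bigr do rewrite dotvE.
rewrite exchange_big; apply: eq_bigr => i _; rewrite dotvE.
by apply: eq_bigr => q _; rewrite ![slice _ _ _ _]mxE.
Qed.

Lemma kron_tr M : (kron_id p M)^T = kron_id p M^T.
Proof.
rewrite tr_mxblock; apply: eq_mxblock => i j.
by rewrite tr_scalar_mx mxE.
Qed.

Lemma kron_psd M v : psdmx M -> 0 <= dotv v (kron_id p M *m v).
Proof.
by move=> [_ M0]; rewrite dotv_slice; apply: sumr_ge0 => q _; rewrite slice_kron.
Qed.

(** Both the operator and the inner product decouple over the slices, so the constant of M carries
    over. *)
Lemma kron_sqr_le M (s : R) v :
  (forall w, dotv (M *m w) (M *m w) <= s * dotv w w) ->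
  dotv (kron_id p M *m v) (kron_id p M *m v) <= s * dotv v v.
Proof.
move=> Ms; rewrite !dotv_slice mulr_sumr; apply: ler_sum => q _.
by rewrite slice_kron.
Qed.

Lemma kron_sqr_le_quad M (s : R) v :
  (forall w, dotv (M *m w) (M *m w) <= s * dotv w (M *m w)) ->
  dotv (kron_id p M *m v) (kron_id p M *m v) <= s * dotv v (kron_id p M *m v).
Proof.
move=> Ms; rewrite !dotv_slice mulr_sumr; apply: ler_sum => q _.
by rewrite slice_kron.
Qed.

(* Jensen's inequality in each row. *)
Lemma doubly_stochastic_contract M (w : 'cV[R]_n) : doubly_stochastic M ->
  dotv (M *m w) (M *m w) <= 1 * dotv w w.
Proof.
move=> [M0 Mr Mc]; rewrite mul1r !dotvE.
apply: (@le_trans _ _ (\sum_i \sum_j M i j * (w j 0 * w j 0))); last first.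
  rewrite exchange_big le_eqVlt; apply/orP; left; apply/eqP.
  by apply: eq_bigr => j _; rewrite -mulr_suml Mc mul1r.
apply: ler_sum => i _; rewrite mxE; set S := \sum_j _ * _.
(* Row i is a probability vector under which w has mean [S]; this is its variance. *)
have : 0 <= \sum_j M i j * (w j 0 - S) ^+ 2.
  by apply: sumr_ge0 => j _; rewrite mulr_ge0 ?sqr_ge0.
have -> : \sum_j M i j * (w j 0 - S) ^+ 2 =
  \sum_j M i j * (w j 0 * w j 0) - 2 * S * S + S ^+ 2.
  rewrite (eq_bigr (fun j => M i j * (w j 0 * w j 0) - 2 * S * (M i j * w j 0)
    + S ^+ 2 * M i j)); last by move=> j _; ring.
  by rewrite big_split /= sumrB -!mulr_sumr Mr mulr1.
lra.
Qed.

End Kron.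

(** * One step of the iteration *)

(** Symmetry of B makes the cross term 2 gamma <y, B v> of |y'|^2 equal to the cross term of gamma
    |v + B y|^2, so both cancel. *)
Lemma dual_step (R : realType) (N : nat) (B : 'M[R]_N) (v y y' m : 'cV[R]_N) (gamma : R) :
  B^T = B -> v = m - B *m y -> y' = y + gamma *: (B *m v) ->
  gamma * dotv v v - gamma ^+ 2 * dotv (B *m v) (B *m v) + dotv y' y' =
  dotv y y - gamma * dotv (B *m y) (B *m y) + gamma * dotv m m.
Proof.
move=> Bsym vE; have -> : m = v + B *m y by rewrite vE subrK.
move=> ->; clear vE; rewrite !(dotvDl, dotvDr, dotvZl, dotvZr).
have -> : dotv (B *m v) y = dotv v (B *m y) by rewrite dotv_mulmxl Bsym.
rewrite [dotv y (B *m v)]dotv_mulmx Bsym (dotvC (B *m y) v); ring.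
Qed.

(* Young's inequality weighted so that C (I - C)^-1 + I <= (1 - r)^-1 I. *)
Lemma mixing_bound (R : realType) (N : nat) (C : 'M[R]_N) (L u : 'cV[R]_N) (r : R) :
  0 <= r < 1 -> dotv (C *m L) (C *m L) <= r * dotv L (C *m L) ->
  dotv (L - C *m L + u) (L - C *m L + u) <=
  dotv L L - dotv L (C *m L) + 2 * dotv L u + dotv u u / (1 - r).
Proof.
move=> /andP[r0 r1] CL; rewrite !dotv_lin.
rewrite (dotvC (C *m L) L) (dotvC u L) (dotvC u (C *m L)).
set w := C *m L in CL *.
suff : dotv w w - dotv L w - 2 * dotv w u + dotv u u <= dotv u u / (1 - r) by lra.
have r1' : 0 < 1 - r by lra.
rewrite ler_pdivlMr //.
have [rr|rr] : r = 0 \/ 0 < r by move: r0; rewrite le_eqVlt => /orP[/eqP|]; auto.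
  have w0 : w = 0.
    by apply/dotv_eq0/eqP; rewrite eq_le dotv_ge0 andbT; move: CL; rewrite rr mul0r.
  by rewrite w0 rr !(dotv0l, dotv0r); lra.
(* r times the gap to be shown non-negative is this square plus [H]; the case r = 0, where w = 0,
   was therefore split off. *)
have := dotv_ge0 ((1 - r) *: w + r *: u); rewrite !dotv_lin (dotvC u w) => sq.
rewrite -subr_ge0 -(pmulr_rge0 _ rr).
have H : 0 <= (1 - r) * (r * dotv L w - dotv w w) by apply: mulr_ge0; lra.
apply: le_trans (addr_ge0 sq H) _; rewrite le_eqVlt; apply/orP; left; apply/eqP; ring.
Qed.

(** The algebraic core of [primal_step], scaled by alpha / beta. The variables [xx], [dd], [gg],
    [gx], [gd], [xd] stand for the inner products of the error x, the increment D = x' - x and the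
    gradient difference G. *)
Lemma primal_step_scalar (R : realType) (a m l th q kap xx dd gg gx gd xd : R) :
  0 < a -> 0 < m -> 0 < l -> 0 <= th -> a * l * (1 + 2 * th) < 1 -> m <= l ->
  0 <= q -> q <= a * m -> m * xx <= gx -> gg <= l * gx ->
  0 <= xx -> 0 <= dd -> 0 <= gg ->
  (forall c, 0 <= dd + 2 * c * gd + c ^+ 2 * gg) ->
  kap = 1 - q * (1 + th) ->
  xx - (1 - kap) * (xx + 2 * xd + dd) - 2 * th * dd - 2 * a * gx - 2 * a * th * gd
    + a ^+ 2 * gg + q * (xx + 2 * (1 + th) * xd + (1 + th) ^+ 2 * dd) <=
  (1 - a * m * (1 - a * l * (1 + 2 * th))) * kap * xx.
Proof.
move=> a0 m0 l0 th0 al ml q0 qm mxx ggl xx0 dd0 gg0 young kapE.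
have am0 : 0 < a * m by exact: mulr_gt0.
have aml : a * m <= a * l by rewrite ler_pM2l.
have al0 : 0 < a * l by exact: mulr_gt0.
have thal : 0 <= th * (a * l) by rewrite mulr_ge0 // ltW.
have qth : 0 <= q * th by exact: mulr_ge0.
have qth1 : q * (1 + th) <= 1.
  have : q * (1 + th) <= a * m * (1 + th) by apply: ler_wpM2r; lra.
  have : a * m * (1 + th) <= a * l * (1 + th) by apply: ler_wpM2r; lra.
  nra.
(* with this kap the cross term xd cancels *)
have Y : - (th * (2 - q * (1 + th))) * dd - 2 * a * th * gd <= a ^+ 2 * th * gg.
  have := mulr_ge0 th0 (young a).
  have : 0 <= th * (1 - q * (1 + th)) * dd by rewrite !mulr_ge0 //; lra.
  nra.
have gx0 : 0 <= gx by apply: le_trans mxx; rewrite mulr_ge0 // ltW.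
(* Cocoercivity trades |G|^2 for <G, x>; [G2] then trades <G, x> for |x|^2 by strong monotonicity,
   the step-size bound making the coefficient non-negative. *)
have G : - 2 * a * gx + a ^+ 2 * (1 + th) * gg <= - (2 * a - a ^+ 2 * l * (1 + th)) * gx.
  have : a ^+ 2 * (1 + th) * gg <= a ^+ 2 * (1 + th) * (l * gx).
    by apply: ler_wpM2l => //; rewrite mulr_ge0 ?sqr_ge0 //; lra.
  lra.
have G2 : (2 * a - a ^+ 2 * l * (1 + th)) * (m * xx) <=
          (2 * a - a ^+ 2 * l * (1 + th)) * gx.
  apply: ler_wpM2l => //.
  have -> : 2 * a - a ^+ 2 * l * (1 + th) = a * (2 - a * l * (1 + th)) by ring.
  by apply: mulr_ge0; [exact: ltW|nra].
have K : kap * (a * m * (1 - a * l * (1 + 2 * th))) * xx <=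
         a * m * (1 - a * l * (1 + 2 * th)) * xx.
  apply: ler_wpM2r => //; apply: ler_piMl.
    by rewrite mulr_ge0 // ?ltW // subr_gt0.
  by rewrite kapE; nra.
have Q : q * xx <= a * m * xx by apply: ler_wpM2r.
have P : 0 <= a * m * (th * (a * l)) * xx by rewrite !mulr_ge0 // ltW.
suff E : xx - (1 - kap) * (xx + 2 * xd + dd) - 2 * th * dd - 2 * a * gx - 2 * a * th * gd
    + a ^+ 2 * gg + q * (xx + 2 * (1 + th) * xd + (1 + th) ^+ 2 * dd) =
   (kap + q) * xx + (- (th * (2 - q * (1 + th))) * dd - 2 * a * th * gd)
    + (- 2 * a * gx + a ^+ 2 * gg).
  rewrite E; nra.
by rewrite kapE; ring.
Qed.

(** The gradient step gives A^T L = - D / alpha - G. After [mixing_bound], with u = beta A (x' +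
    theta D), all terms but <L, L> and <L, C L> are inner products of x, D and G. *)
Lemma primal_step (R : realType) (N k : nat) (A : 'M[R]_(N, k)) (C : 'M[R]_N)
    (x x' G : 'cV[R]_k) (L : 'cV[R]_N) (w : 'cV[R]_N)
    (a b m l th r s kap : R) :
  0 < a -> 0 < b -> 0 < m -> 0 < l -> 0 <= th -> a * l * (1 + 2 * th) < 1 -> m <= l ->
  0 <= r < 1 -> 0 <= s -> b * s / (1 - r) <= m ->
  dotv (C *m L) (C *m L) <= r * dotv L (C *m L) -> 0 <= dotv L (C *m L) ->
  (forall z, dotv (A *m z) (A *m z) <= s * dotv z z) ->
  m * dotv x x <= dotv G x -> dotv G G <= l * dotv G x ->
  x' = x - a *: (G + A^T *m L) ->
  w = L - C *m L + b *: (A *m (x' + th *: (x' - x))) ->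
  kap = 1 - a * (b * s / (1 - r)) * (1 + th) ->
  kap * (b / a) * dotv x' x' + dotv w w <=
  (1 - a * m * (1 - a * l * (1 + 2 * th))) * (kap * (b / a) * dotv x x) + dotv L L
  - a * b * dotv L ((A *m A^T + (2 * a * b)^-1 *: C) *m L).
Proof.
move=> a0 b0 m0 l0 th0 al ml rr s0 bs CL CL0 As Gx GG x'E wE kapE.
have /andP[r0 r1] := rr.
set D := x' - x; have x'D : x' = x + D by rewrite addrC subrK.
have AL : A^T *m L = - (a^-1 *: D) - G.
  rewrite /D x'E addrAC subrr add0r scalerN opprK scalerA mulVf ?gt_eqF //.
  by rewrite scale1r addrC addKr.
have q0 : 0 <= a * (b * s / (1 - r)).
  by apply: mulr_ge0; [exact: ltW | apply: divr_ge0; [apply: mulr_ge0 => //; exact: ltW | lra]].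
have qm : a * (b * s / (1 - r)) <= a * m by rewrite ler_pM2l.
pose xh := x' + th *: D.
have W : dotv w w <= dotv L L - dotv L (C *m L) + 2 * b * dotv (A^T *m L) xh
    + b * (b * s / (1 - r)) * dotv xh xh.
  rewrite wE; apply: le_trans (mixing_bound _ rr CL) _.
  rewrite !(dotvZl, dotvZr) [dotv L (A *m _)]dotv_mulmx -/D -/xh mulrA lerD2l.
  rewrite ler_pdivrMr; last by lra.
  have -> : b * (b * s / (1 - r)) * dotv xh xh * (1 - r) = b * (b * (s * dotv xh xh)).
    by field; lra.
  by rewrite !ler_pM2l.
(* The factor 1 / (2 alpha beta) in E absorbs half of the <L, C L> gained in [W]; the other half is
   non-negative and is dropped at the end. *)
have LE : a * b * dotv L ((A *m A^T + (2 * a * b)^-1 *: C) *m L) =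
    a * b * dotv (A^T *m L) (A^T *m L) + dotv L (C *m L) / 2.
  rewrite mulmxDl dotvDr -scalemxAl dotvZr -mulmxA [dotv L (A *m _)]dotv_mulmx.
  by field; rewrite !gt_eqF.
rewrite LE; apply: le_trans (lerD (lexx _) W) _.
clearbody D.
have young c : 0 <= dotv D D + 2 * c * dotv G D + c ^+ 2 * dotv G G.
  have := dotv_ge0 (D + c *: G); rewrite !dotv_lin (dotvC D G) => /le_trans; apply.
  by rewrite le_eqVlt; apply/orP; left; apply/eqP; ring.
have := primal_step_scalar (dotv x D) a0 m0 l0 th0 al ml q0 qm Gx GG
  (dotv_ge0 x) (dotv_ge0 D) (dotv_ge0 G) young kapE.
rewrite /xh AL x'D !dotv_lin ?(dotvC D x) ?(dotvC D G) ?(dotvC x G).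
have ab : 0 < b / a by exact: divr_gt0.
rewrite -(ler_pM2l ab).
move: kapE; set q := b * s / (1 - r) => kapE; clearbody q.
move=> H; rewrite -subr_ge0; rewrite -subr_ge0 in H.
apply: le_trans (addr_ge0 H (divr_ge0 CL0 (ler0n _ 2))) _.
rewrite le_eqVlt; apply/orP; left; apply/eqP; rewrite kapE; field.
by rewrite gt_eqF.
Qed.

(** * Conjugates, proximal maps and the dual solution *)

Section Convex.
Variable R : realType.

Lemma adde_def_gtNy (a b : \bar R) : (-oo < a -> -oo < b -> a +? b)%E.
Proof. by case: a b => [a||] [b||]. Qed.

Lemma conjugate_gtNy m (h : 'cV[R]_m -> \bar R) lam :
  proper_fun h -> (-oo < conjugate h lam)%E.
Proof.
move=> [hN [z hz]]; apply: (@lt_le_trans _ _ ((dotv lam z)%:E - h z)%E).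
  by have := hN z; case: (h z) hz => [r||] // _ _; rewrite -EFinB ltNyr.
by apply: ereal_sup_ubound; exists z.
Qed.

Lemma econvex_conjugate m (h : 'cV[R]_m -> \bar R) :
  proper_fun h -> econvex (conjugate h).
Proof.
move=> hproper x y t /andP[t0 t1]; apply: ge_ereal_sup => _ [z _ <-].
have ub w : ((dotv w z)%:E - h z <= conjugate h w)%E.
  by apply: ereal_sup_ubound; exists z.
have hz := hproper.1 z; move: (ub x) (ub y); case: (h z) hz => [r||] // _.
  rewrite -!EFinB => Hx Hy.
  have t0' : (0 <= t%:E)%E by rewrite lee_fin.
  have t1' : (0 <= (1 - t)%:E)%E by rewrite lee_fin subr_ge0.
  apply: le_trans (leeD (lee_wpmul2l t0' Hx) (lee_wpmul2l t1' Hy)).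
  by rewrite -!EFinM -EFinD lee_fin !dotv_lin; lra.
by move=> _ _; exact: leNye.
Qed.

(** Properness of h keeps every term above -oo, which is what licenses the distributive laws on
    extended reals. *)
Lemma econvex_avg_conjugate n p (h : 'cV[R]_p -> \bar R) :
  proper_fun h -> econvex (@avg_conjugate R n p h).
Proof.
move=> hproper x y t t01; have /andP[t0 t1] := t01.
have t1' : 0 <= 1 - t by rewrite subr_ge0.
have cN (c : R) (i : 'I_n) (z : 'cV[R]_(\sum_(i < n) p)) :
    0 <= c -> (-oo < c%:E * conjugate h (submxcol z i))%E.
  move=> c0; have := conjugate_gtNy (submxcol z i) hproper.
  case: (conjugate h _) => [r||] // _; first by rewrite -EFinM ltNyr.
  have [->|cN0] := eqVneq c 0; first by rewrite mul0e.
  by rewrite gt0_muley ?ltNyy // lte_fin lt_def cN0.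
have sN (c : R) (z : 'cV[R]_(\sum_(i < n) p)) : 0 <= c ->
    (-oo < \sum_(i < n) c%:E * conjugate h (submxcol z i))%E.
  move=> c0; elim/big_ind: _ => [|a b|i _]; [by rewrite ltNyr| |exact: cN].
  by case: a b => [a||] [b||] // _ _; rewrite -EFinD ltNyr.
have nN : (0 <= (n%:R^-1 : R)%:E)%E by rewrite lee_fin invr_ge0.
have distr (c : R) z : 0 <= c -> (c%:E * avg_conjugate h z =
    n%:R^-1%:E * \sum_(i < n) c%:E * conjugate h (submxcol z i))%E.
  move=> c0; rewrite /avg_conjugate muleCA fin_num_sume_distrr // => i j _ _.
  by apply: adde_def_gtNy; apply: conjugate_gtNy.
rewrite !distr // -muleDr //; last by apply: adde_def_gtNy; exact: sN.
apply: lee_wpmul2l => //; rewrite -big_split /=; apply: lee_sum => i _.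
by rewrite submxcolD !submxcolZ; exact: econvex_conjugate.
Qed.

Lemma prox_const0 m (phi : 'cV[R]_m -> \bar R) (alpha : R) x z : 0 < alpha ->
  (forall y, phi y = 0%E) -> prox alpha phi x z -> z = x.
Proof.
move=> a0 phi0 /(_ x); rewrite !phi0 !add0e lee_fin !enorm_sqr subrr dotv0l mulr0.
rewrite pmulr_rle0 ?invr_gt0 ?mulr_gt0 // => zx.
by apply/eqP; rewrite -subr_eq0; apply/eqP/dotv_eq0/eqP; rewrite eq_le zx dotv_ge0.
Qed.

(* b is characterised as the proximal point of u by the subgradient
   (u - b) / beta, and a as that of w by minimality. *)
Lemma prox_nonexpansive m (H : 'cV[R]_m -> \bar R) (beta hb : R) (a b u w : 'cV[R]_m) :
  0 < beta -> econvex H -> H b = hb%:E ->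
  (forall y, ((hb + beta^-1 * dotv (u - b) (y - b))%:E <= H y)%E) ->
  prox beta H w a ->
  dotv (a - b) (a - b) <= dotv (w - u) (w - u).
Proof.
move=> b0 Hconv Hb Hsub amin.
have : (H a < +oo)%E.
  have := amin b; rewrite Hb -EFinD.
  by case: (H a) => // r _; rewrite ltry.
have := Hsub a; have := amin; case Ha : (H a) => [ha||] // _.
rewrite lee_fin => Hab _.
(* The variational inequality of the proximal point a. Added to the subgradient bound at a it gives
   |a - b|^2 <= <w - u, a - b>, and |w - u - (a - b)|^2 >= 0 concludes. It is itself proved by
   minimality along the segment from a to b. *)
suff : dotv (w - a) (b - a) <= beta * (hb - ha).
  move: Hab; rewrite -subr_ge0 -(pmulr_rge0 _ b0).
  have -> : beta * (ha - (hb + beta^-1 * dotv (u - b) (a - b))) =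
    beta * (ha - hb) - dotv (u - b) (a - b) by field; rewrite gt_eqF.
  have := dotv_ge0 (w - u - (a - b)).
  have -> : w - a = (w - u) + (u - b) - (a - b).
    by rewrite addrA subrK opprB addrA subrK.
  rewrite -(opprB a b); set e := a - b; set r := w - u; set s := u - b; clearbody e r s.
  rewrite !dotv_lin ?(dotvC e r) ?(dotvC e s) ?(dotvC s r); lra.
rewrite -ler_pdivrMl //.
apply: (@le_of_quadratic_error _ _ _ ((2 * beta)^-1 * dotv (b - a) (b - a))).
move=> t /andP[t0 t1].
have := Hconv b a t; rewrite (ltW t0) t1 Ha Hb -!EFinM -EFinD => /(_ erefl) conv.
have := amin (t *: b + (1 - t) *: a); rewrite Ha !enorm_sqr.
move=> /le_trans/(_ (leeD conv (lexx _))); rewrite -!EFinD lee_fin.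
have -> : t *: b + (1 - t) *: a - w = (a - w) + t *: (b - a).
  by rewrite scalerBl scalerBr scale1r; apply/colP => i; rewrite !mxE; ring.
rewrite -(opprB a w); set e := a - w; set d := b - a; clearbody e d.
rewrite !(dotvDl, dotvDr, dotvNl, dotvZl, dotvZr) (dotvC d e).
have -> : beta^-1 = 2 * (2 * beta)^-1 by field; rewrite gt_eqF.
lra.
Qed.

(* The optimality condition of F + h o A yields the multiplier -Q^T g, where Q
   is a right inverse of A. *)
Lemma exists_multiplier m k (F : 'cV[R]_k -> R) (h : 'cV[R]_m -> \bar R)
    (A : 'M[R]_(m, k)) (xs g : 'cV[R]_k) (c : 'cV[R]_k -> R) :
  (forall d t, F (xs + t *: d) <= F xs + t * dotv g d + t ^+ 2 * c d) ->
  proper_fun h -> econvex h -> row_free A ->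
  (forall x, ((F xs)%:E + h (A *m xs)%R <= (F x)%:E + h (A *m x)%R)%E) ->
  exists ls r, [/\ g + A^T *m ls = 0, h (A *m xs) = r%:E &
    forall w, ((r + dotv ls (w - A *m xs))%:E <= h w)%E].
Proof.
move=> Fquad [hN [w0 hw0]] hconv /row_freeP[Q AQ] xsmin.
(* Surjectivity of A reaches a point [w0] where h is finite, so the optimal value is finite. *)
have [r hr] : exists r, h (A *m xs) = r%:E.
  have := xsmin (Q *m w0); rewrite mulmxA AQ mul1mx.
  have := hN (A *m xs); case: (h (A *m xs)) => [r||] // _; first by exists r.
  by case: (h w0) hw0 => //= s _; rewrite leye_eq.
(* The one-sided optimality condition in direction d: the slope of F plus the chord increment of h
   is non-negative. *)
have opt (d : 'cV[R]_k) (s : R) : h (A *m (xs + d)) = s%:E -> r - s <= dotv g d.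
  move=> hs; apply: (@le_of_quadratic_error _ _ _ (c d)) => t /andP[t0 t1].
  have := hconv (A *m (xs + d)) (A *m xs) t.
  rewrite (ltW t0) t1 hs hr -!EFinM -EFinD => /(_ erefl).
  have -> : t *: (A *m (xs + d)) + (1 - t) *: (A *m xs) = A *m (xs + t *: d).
    rewrite !mulmxDr -scalemxAr; move: (A *m xs) (A *m d) => u v.
    by apply/colP => i; rewrite !mxE; ring.
  move=> conv; have := xsmin (xs + t *: d); rewrite hr.
  move=> /le_trans/(_ (leeD (lexx _) conv)); rewrite -!EFinD lee_fin.
  by have := Fquad d t; lra.
have orth (z : 'cV[R]_k) : A *m z = 0 -> dotv g z = 0.
  have le0 (y : 'cV[R]_k) : A *m y = 0 -> 0 <= dotv g y.
    by move=> Ay; have := opt y r; rewrite mulmxDr Ay addr0 subrr => /(_ hr).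
  move=> Az; apply/eqP; rewrite eq_le le0 // andbT -oppr_ge0 -dotvNr le0 //.
  by rewrite mulmxN Az oppr0.
exists (- (Q^T *m g)), r; split=> // [|w].
  rewrite mulmxN; apply: dotv_eq0; set z := _ - _.
  (* The vector z - Q A z lies in the kernel of A, to which g is orthogonal. *)
  have <- : dotv g (z - Q *m (A *m z)) = dotv z z.
    by rewrite dotvBr [dotv g (Q *m _)]dotv_mulmx [dotv _ (A *m z)]dotv_mulmx -dotvBl.
  by rewrite orth // mulmxBr mulmxA AQ mul1mx subrr.
have := hN w; case hw : (h w) => [s||] // _; last by rewrite leey.
have := opt (Q *m (w - A *m xs)) s; rewrite mulmxDr mulmxA AQ mul1mx addrC subrK.
move=> /(_ hw); rewrite dotvNl -dotv_mulmx lee_fin; lra.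
Qed.

(** Equality in Fenchel-Young: the subgradient inequality says that the supremum defining the
    conjugate at [ls] is attained at z. The affine term indexed by z then minorises the conjugate
    and touches it at [ls]. *)
Lemma conjugate_subgradient m (h : 'cV[R]_m -> \bar R) (z ls : 'cV[R]_m) (r : R) :
  h z = r%:E -> (forall w, ((r + dotv ls (w - z))%:E <= h w)%E) ->
  conjugate h ls = (dotv ls z - r)%:E /\
  forall lam, ((dotv ls z - r + dotv z (lam - ls))%:E <= conjugate h lam)%E.
Proof.
move=> hz hsub.
have lb lam : ((dotv lam z - r)%:E <= conjugate h lam)%E.
  by apply: ereal_sup_ubound; exists z => //; rewrite hz.
split=> [|lam]; last first.
  by apply: le_trans (lb lam); rewrite lee_fin !dotv_lin !(dotvC z); lra.
apply/eqP; rewrite eq_le lb andbT; apply: ge_ereal_sup => _ [w _ <-].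
have := hsub w; case: (h w) => [s||] //; last by rewrite leNye.
by rewrite !lee_fin !dotv_lin; lra.
Qed.

(** The average scales the stacked subgradient by 1 / n, the source of beta / n in the fixed point
    [us] of the theorem. *)
Lemma avg_conjugate_subgradient n p (h : 'cV[R]_p -> \bar R) (z ls : 'cV[R]_p) (r : R) :
  (0 < n)%N -> h z = r%:E -> (forall w, ((r + dotv ls (w - z))%:E <= h w)%E) ->
  avg_conjugate h (stack n ls) = (dotv ls z - r)%:E /\
  forall lam, ((dotv ls z - r + n%:R^-1 * dotv (stack n z) (lam - stack n ls))%:E
    <= avg_conjugate h lam)%E.
Proof.
move=> n0 hz hsub; have [cE csub] := conjugate_subgradient hz hsub.
have nN0 : n%:R != 0 :> R by rewrite pnatr_eq0 -lt0n.
split=> [|lam].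
  rewrite /avg_conjugate; under eq_bigr do rewrite submxcol_stack cE.
  by rewrite sumEFin sumr_const card_ord -EFinM -[(_ - _) *+ n]mulr_natl mulrA mulVf // mul1r.
rewrite /avg_conjugate.
have : (\sum_(i < n) (dotv ls z - r + dotv z (submxcol lam i - ls))%:E <=
        \sum_(i < n) conjugate h (submxcol lam i))%E by apply: lee_sum.
move=> /(lee_wpmul2l (x := (n%:R^-1)%:E)); rewrite lee_fin invr_ge0 ler0n => /(_ isT).
apply: le_trans; rewrite sumEFin -EFinM lee_fin.
have -> : dotv (stack n z) (lam - stack n ls) = \sum_(i < n) dotv z (submxcol lam i - ls).
  rewrite dotv_submxcol; apply: eq_bigr => i _.
  by rewrite submxcolB !submxcol_stack.
rewrite big_split /= mulrDr.
have -> : \sum_(i < n) (dotv ls z - r) = n%:R * (dotv ls z - r).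
  by rewrite sumr_const card_ord mulr_natl.
by rewrite mulrA mulVf // mul1r.
Qed.

End Convex.

(** * Network matrices *)

Section Network.
Variables (R : realType) (n : nat).
Local Notation ones := (const_mx 1 : 'rV[R]_n).

Lemma kron_stack p (M : 'M[R]_n) (c : R) (w : 'cV[R]_p) :
  M *m const_mx 1 = c *: const_mx 1 :> 'cV_n ->
  kron_id p M *m stack n w = c *: stack n w.
Proof.
move=> M1; apply: slice_inj => q.
by rewrite slice_kron sliceZ slice_stack -scalemxAr M1 !scalerA mulrC.
Qed.

Lemma stochastic_ones (D : 'M[R]_n) : doubly_stochastic D ->
  D *m const_mx 1 = 1 *: const_mx 1 :> 'cV_n.
Proof.
move=> [_ Dr _]; apply/colP => i; rewrite !mxE mul1r -[RHS](Dr i).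
by apply: eq_bigr => j _; rewrite !mxE mulr1.
Qed.

Lemma ones_mul (y : 'cV[R]_n) : ones *m y = (\sum_i y i 0)%:M.
Proof.
rewrite [LHS]mx11_scalar mxE; congr (_%:M).
by apply: eq_bigr => i _; rewrite mxE mul1r.
Qed.

Lemma nullspace_ones (B : 'M[R]_n) : nullspace B = span_ones R n ->
  B *m const_mx 1 = 0 *: const_mx 1 :> 'cV_n.
Proof.
move=> nB; rewrite scale0r; have : span_ones R n (const_mx 1).
  by exists 1 => //; rewrite scale1r.
by rewrite -nB.
Qed.

(** * Inverting a consensus matrix on the vectors of zero sum *)

Section Consensus.
Variable B : 'M[R]_n.
Hypotheses (n0 : (0 < n)%N) (Bsym : B^T = B) (nullB : nullspace B = span_ones R n).

Lemma ones_null : ones *m B = 0.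
Proof.
rewrite -[LHS]trmxK trmx_mul Bsym trmx_const.
by rewrite nullspace_ones // scale0r trmx0.
Qed.

Lemma null_ones_eq0 (y : 'cV[R]_n) : ones *m y = 0 -> B *m y = 0 -> y = 0.
Proof.
move=> y1 By; have : nullspace B y by [].
rewrite nullB => -[a _ ya]; move: y1; rewrite -ya ones_mul.
under eq_bigr do rewrite !mxE mulr1.
rewrite sumr_const card_ord => /matrixP/(_ 0 0).
rewrite !mxE eqxx mulr1n => /eqP; rewrite mulrn_eq0 eqn0Ngt n0 /= => /eqP ->.
by rewrite scale0r.
Qed.

(* (B + 1 1^T)^-1 inverts B on the orthogonal complement of the ones vector. *)
Lemma consensus_inverse : exists P : 'M[R]_n, forall r : 'cV[R]_n,
  ones *m r = 0 -> ones *m (P *m r) = 0 /\ B *m (P *m r) = r.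
Proof.
pose M := B + ones^T *m ones.
have n1 : ones *m ones^T = n%:R%:M.
  by rewrite ones_mul; under eq_bigr do rewrite !mxE; rewrite sumr_const card_ord.
have nN0 : n%:R != 0 :> R by rewrite pnatr_eq0 -lt0n.
have onesM (y : 'cV[R]_n) : ones *m (M *m y) = n%:R *: (ones *m y).
  rewrite mulmxA /M mulmxDr ones_null add0r mulmxA n1.
  by rewrite mul_scalar_mx -scalemxAl.
have Minv (y r : 'cV[R]_n) : M *m y = r -> ones *m r = 0 -> ones *m y = 0 /\ B *m y = r.
  move=> My r1.
  have y1 : ones *m y = 0.
    apply/eqP; move/eqP: (onesM y).
    by rewrite My r1 eq_sym scaler_eq0 (negbTE nN0).
  by split=> //; rewrite -My /M mulmxDl -mulmxA y1 mulmx0 addr0.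
have Msym : M^T = M by rewrite /M linearD /= Bsym trmx_mul trmxK.
(* The transpose of a left kernel row solves M y = 0; by [Minv] with r = 0 it is in the null space
   of B and orthogonal to the ones vector, hence zero. *)
have Munit : M \in unitmx.
  rewrite -row_free_unit -kermx_eq0; apply/eqP/row_matrixP => i; rewrite row0.
  apply: trmx_inj; rewrite trmx0.
  have [|y1 By] := Minv (row i (kermx M))^T 0 _ (mulmx0 _ _).
    by rewrite -{1}Msym -trmx_mul -row_mul mulmx_ker row0 trmx0.
  exact: null_ones_eq0.
exists (invmx M) => r r1; apply: Minv => //.
by rewrite mulmxA mulmxV // mul1mx.
Qed.

End Consensus.

(** If the quadratic form vanishes at v, so do both summands. The one of C forces all blocks of v to
    equal some w; the other then gives A_i^T w = 0 for every i, and full row rank gives w = 0. *)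
Lemma pd_dual_operator p (d : 'I_n -> nat) (A : forall i, 'M[R]_(p, d i)) (C : 'M[R]_n)
    (t : R) : (0 < n)%N -> 0 < t -> psdmx C -> nullspace C = span_ones R n ->
  row_free (row_blocks A) ->
  pdmx (diag_blocks A *m (diag_blocks A)^T + t *: kron_id p C).
Proof.
move=> n0 t0 Cpsd nullC Afree; have [Csym _] := Cpsd.
split=> [|v vN0]; first by rewrite linearD linearZ /= trmx_mul trmxK kron_tr Csym.
rewrite mulmxDl dotvDr -scalemxAl dotvZr -mulmxA dotv_mulmx.
have Cv0 := kron_psd v Cpsd; have Av0 := dotv_ge0 ((diag_blocks A)^T *m v).
rewrite lt_def addr_ge0 ?mulr_ge0 ?(ltW t0) // andbT; apply: contra vN0.
rewrite paddr_eq0 ?mulr_ge0 ?(ltW t0) // mulf_eq0 (gt_eqF t0) /=.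
move=> /andP[/eqP/dotv_eq0 Av /eqP Cv].
have {}Cv : kron_id p C *m v = 0.
  apply/dotv_eq0/eqP; rewrite eq_le dotv_ge0 andbT -(mulr0 (sigma_max C)) -Cv.
  by apply: kron_sqr_le_quad => w; exact: psd_sqr_le.
pose w := submxcol v (Ordinal n0).
have vw : v = stack n w.
  apply: slice_inj => q.
  have : nullspace C (slice q v) by rewrite /nullspace /= -slice_kron Cv slice0.
  rewrite nullC slice_stack => -[a _ aE]; rewrite -aE; congr (_ *: _).
  by move/colP: aE => /(_ (Ordinal n0)); rewrite !mxE mulr1.
have wA : (row_blocks A)^T *m w = 0.
  apply: submxcol_inj => i; rewrite submxcol_row_blocksT submxcol0.
  have := submxcol_diag_blocksT A (stack n w) i.
  by rewrite submxcol_stack -vw Av submxcol0.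
have w0 : w = 0.
  apply: trmx_inj; rewrite trmx0; apply/eqP.
  rewrite -(mulmx_free_eq0 _ Afree); apply/eqP/trmx_inj.
  by rewrite trmx_mul trmxK wA trmx0.
by rewrite vw w0; apply/eqP/submxcol_inj => i; rewrite submxcol_stack submxcol0.
Qed.

End Network.

(** * Convergence *)

Lemma inf_range_ord (R : realType) n (F : 'I_n -> R) : (0 < n)%N ->
  (forall i, inf (range F) <= F i) /\ exists i, inf (range F) = F i.
Proof.
case: n F => // n F _; pose i0 := [arg min_(i < ord0 : 'I_n.+1) F i]%O.
have min i : F i0 <= F i by rewrite /i0; case: arg_minP => //= j _; exact.
have -> : inf (range F) = F i0.
  apply/eqP; rewrite eq_le; apply/andP; split.
    by apply: ge_inf; [exists (F i0) => _ [i _ <-]|exists i0].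
  by apply: lb_le_inf; [exists (F i0); exists i0|move=> _ [i _ <-]].
by split=> //; exists i0.
Qed.

Lemma le_sup_range_ord (R : realType) n (F : 'I_n -> R) i : F i <= sup (range F).
Proof.
apply: ub_le_sup; last by exists i.
exists (\sum_j `|F j|) => _ [j _ <-]; rewrite (bigD1 j) //=.
by apply: le_trans (ler_norm _) _; rewrite lerDl sumr_ge0.
Qed.

Lemma geometric_eqO (R : realType) (u V : nat -> R) (c delta : R) :
  0 < c -> 0 < delta -> (forall k, 0 <= u k) ->
  (forall k, c * u k <= V k) -> (forall k, V k.+1 <= delta * V k) ->
  u =O_\oo (fun k => delta ^+ k).
Proof.
move=> c0 d0 u0 uV Vd; apply/eqO_exP.
have Vk k : V k <= delta ^+ k * V 0%N.
  elim: k => [|k IH]; first by rewrite expr0 mul1r.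
  apply: le_trans (Vd k) _; rewrite exprS -mulrA.
  by rewrite ler_pM2l.
have V0 : 0 <= V 0%N by apply: le_trans (uV 0%N); rewrite mulr_ge0 // ltW.
have uk k : u k <= (V 0%N / c + 1) * delta ^+ k.
  have dk : 0 <= delta ^+ k by rewrite exprn_ge0 // ltW.
  rewrite mulrDl mul1r ler_wpDr // mulrAC ler_pdivlMr // [u k * c]mulrC (mulrC (V 0%N)).
  exact: le_trans (uV k) (Vk k).
(* The added 1 keeps the constant positive even if V 0 = 0. *)
exists (V 0%N / c + 1); first by rewrite ltr_wpDl // divr_ge0 // ltW.
by apply: nearW => k; rewrite !ger0_norm ?exprn_ge0 // ?ltW.
Qed.

Lemma sum_gradient_bounds (R : realType) (n : nat) (d : 'I_n -> nat)
    (f : forall i, 'cV[R]_(d i) -> R) (mu_ l_ : 'I_n -> R) (mu l : R)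
    (x y : 'cV[R]_(\sum_i d i)) :
  0 <= mu ->
  (forall i, [/\ 0 < mu_ i, mu_ i <= l_ i,
                 strongly_convex (mu_ i) (f i) & smooth (l_ i) (f i)]) ->
  (forall i, mu <= mu_ i) -> (forall i, l_ i <= l) ->
  let G := gradient (sum_fun f) x - gradient (sum_fun f) y in
  mu * dotv (x - y) (x - y) <= dotv G (x - y) /\ dotv G G <= l * dotv G (x - y).
Proof.
move=> mu0 fH mule lle G; rewrite !dotv_submxcol !mulr_sumr.
have GE i : submxcol G i = gradient (f i) (submxcol x i) - gradient (f i) (submxcol y i).
  have fd k z : differentiable (f k) z by have [_ _ _ []] := fH k.
  by rewrite submxcolB !gradient_sum_fun.
have mono i : mu_ i * dotv (submxcol (x - y) i) (submxcol (x - y) i) <=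
    dotv (submxcol G i) (submxcol (x - y) i).
  have [_ _ fc fs] := fH i.
  by rewrite GE submxcolB; exact: (gradient_strongly_monotone fs fc).
split; apply: ler_sum => i _; have [mi0 mil fc fs] := fH i.
  by apply: le_trans (mono i); rewrite ler_wpM2r ?dotv_ge0.
apply: (@le_trans _ _ (l_ i * dotv (submxcol G i) (submxcol (x - y) i))).
  rewrite GE submxcolB; apply: (gradient_cocoercive fs fc); first exact: ltW.
  exact: lt_le_trans mil.
(* Enlarging l_i to l needs each blockwise inner product to be non-negative, which is strong
   monotonicity. *)
by rewrite ler_wpM2r // (le_trans _ (mono i)) // mulr_ge0 ?dotv_ge0 // ltW.
Qed.

(** The blockwise descent lemma along a line, in the form that [exists_multiplier] expects. *)
Lemma sum_fun_quad (R : realType) (n : nat) (d : 'I_n -> nat)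
    (f : forall i, 'cV[R]_(d i) -> R) (l_ : 'I_n -> R) (x v : 'cV[R]_(\sum_i d i)) (t : R) :
  (forall i, smooth (l_ i) (f i)) ->
  sum_fun f (x + t *: v) <= sum_fun f x + t * dotv (gradient (sum_fun f) x) v +
    t ^+ 2 * \sum_i (l_ i / 2 * dotv (submxcol v i) (submxcol v i)).
Proof.
move=> fs; rewrite dotv_submxcol !mulr_sumr /sum_fun -!big_split; apply: ler_sum => i _ /=.
rewrite gradient_sum_fun => [|k z]; last by have [] := fs k.
rewrite submxcolD submxcolZ; apply: le_trans (smooth_upper (fs i) _ _) _.
by rewrite !dotv_lin; lra.
Qed.

(** In [dual_step], |B v|^2 is bounded above by sB |v|^2 and |B y|^2 below by smin |y|^2. The
    weights of P, |L|^2 and |y|^2 then shrink by one argument of the maximum each; the quotient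
    comes from the weight 1 - gamma sB of |L|^2. *)
Lemma lyapunov_step (R : realType) (N : nat) (B : 'M[R]_N) (v y w L L' : 'cV[R]_N)
    (gamma sB smin P P' d1 ae delta : R) :
  B^T = B -> 0 < gamma -> 0 < 1 - gamma * sB -> v = w - B *m y ->
  dotv (B *m v) (B *m v) <= sB * dotv v v ->
  smin * dotv y y <= dotv (B *m y) (B *m y) ->
  dotv L' L' <= dotv v v -> P' + dotv w w <= d1 * P + (1 - ae) * dotv L L ->
  0 <= P -> d1 <= delta -> (1 - ae) / (1 - gamma * sB) <= delta -> 1 - gamma * smin <= delta ->
  P' + (1 - gamma * sB) * dotv L' L'
    + gamma^-1 * dotv (y + gamma *: (B *m v)) (y + gamma *: (B *m v)) <=
  delta * (P + (1 - gamma * sB) * dotv L L + gamma^-1 * dotv y y).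
Proof.
move=> Bsym g0 gs vE Bv By L'v primal P0 dd1 dd2 dd3.
set y' := y + _; have dual := dual_step Bsym vE (erefl y').
have gi : 0 < gamma^-1 by rewrite invr_gt0.
have dualle : (1 - gamma * sB) * dotv v v + gamma^-1 * dotv y' y' <=
    (1 - gamma * smin) * (gamma^-1 * dotv y y) + dotv w w.
  rewrite -(ler_pM2l g0).
  have -> : gamma * ((1 - gamma * sB) * dotv v v + gamma^-1 * dotv y' y') =
    gamma * dotv v v - gamma ^+ 2 * (sB * dotv v v) + dotv y' y' by field; rewrite gt_eqF.
  have -> : gamma * ((1 - gamma * smin) * (gamma^-1 * dotv y y) + dotv w w) =
    dotv y y - gamma * (smin * dotv y y) + gamma * dotv w w by field; rewrite gt_eqF.
  have : gamma ^+ 2 * dotv (B *m v) (B *m v) <= gamma ^+ 2 * (sB * dotv v v).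
    by rewrite ler_wpM2l ?sqr_ge0.
  have : gamma * (smin * dotv y y) <= gamma * dotv (B *m y) (B *m y) by rewrite ler_pM2l.
  lra.
have Lle : (1 - gamma * sB) * dotv L' L' <= (1 - gamma * sB) * dotv v v by rewrite ler_pM2l.
have t1 : d1 * P <= delta * P by rewrite ler_wpM2r.
have t2 : (1 - ae) * dotv L L <= delta * (1 - gamma * sB) * dotv L L.
  by rewrite ler_wpM2r ?dotv_ge0 // -ler_pdivrMr.
have t3 : (1 - gamma * smin) * (gamma^-1 * dotv y y) <= delta * (gamma^-1 * dotv y y).
  by rewrite ler_wpM2r // mulr_ge0 ?dotv_ge0 // ltW.
lra.
Qed.


Theorem theorem1 (R : realType) (n p : nat) (d : 'I_n -> nat)
  (f : forall i, 'cV[R]_(d i) -> R) (g : forall i, 'cV[R]_(d i) -> \bar R)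
  (h : 'cV[R]_p -> \bar R) (A : forall i, 'M[R]_(p, d i))
  (mu_ l_ : 'I_n -> R) (e : rel 'I_n) (B C D : 'M[R]_n)
  (alpha beta gamma theta : R)
  (x xhat : nat -> 'cV[R]_(\sum_i d i))
  (v y lam : nat -> 'cV[R]_(\sum_(i < n) p))
  (xs : 'cV[R]_(\sum_i d i)) :
  (0 < n)%N ->
  (* x* solves the problem *)
  argmin (objective f g h A) xs ->
  (* (1) *)
  (exists x0 lam0, saddle_point (lagrangian f g h A) x0 lam0) ->
  (* (2) *)
  symmetric e -> (forall i j, connect e i j) ->
  (* (3) *)
  (forall i, [/\ 0 < mu_ i, mu_ i <= l_ i,
                 strongly_convex (mu_ i) (f i) & smooth (l_ i) (f i)]) ->
  (forall i, [/\ proper_fun (g i), econvex (g i) &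
                 lower_semicontinuous (g i)]) ->
  [/\ proper_fun h, econvex h & lower_semicontinuous h] ->
  (* (4) *)
  [/\ B^T = B, C^T = C & D^T = D] ->
  C = 0 \/ nullspace C = span_ones R n ->
  nullspace B = span_ones R n ->
  [/\ psdmx C, pdmx (1%:M - C) & psdmx (1%:M - B *m B)] ->
  doubly_stochastic D ->
  (* (5) *)
  (forall i z, g i z = 0%E) -> row_free (row_blocks A) ->
  (* (6) *)
  nullspace C = span_ones R n ->
  npga f g h A B C D alpha beta gamma theta x xhat v y lam ->
  y 0%N = 0 ->
  0 <= theta -> 0 < alpha -> 0 < beta -> 0 < gamma ->
  let mu := inf (range mu_) in
  let l := sup (range l_) in
  let bA := diag_blocks A in
  let E := bA *m bA^T + (2 * alpha * beta)^-1 *: kron_id p C in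
  alpha < 1 / (l * (1 + 2 * theta)) ->
  beta <= mu / (sigma_max bA ^+ 2 * (1 / (1 - sigma_max C) + theta)) ->
  gamma < Num.min 1 (alpha * beta * eta_min E / sigma_max B ^+ 2) ->
  let delta :=
    Num.max (1 - alpha * mu * (1 - alpha * l * (1 + 2 * theta)))
      (Num.max ((1 - alpha * beta * eta_min E) / (1 - gamma * sigma_max B ^+ 2))
               (1 - gamma * sigma_min B ^+ 2)) in
  0 < delta < 1 /\
  (fun k => enorm (x k - xs) ^+ 2) =O_\oo (fun k => delta ^+ k).
Proof.
move=> n0 xsmin _ _ _ fH _ [hproper hconv _] [Bsym Csym Dsym] _ nullB [Cpsd Cpd Bpsd]
  Dst g0 Afree nullC alg y0 th0 a0 b0 c0 mu l bA E alpha_lt beta_le gamma_lt delta.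
have [mule [imu imuE]] := inf_range_ord mu_ n0.
have lle := le_sup_range_ord l_; rewrite -/l in lle.
rewrite -/mu in mule imuE.
have mu0 : 0 < mu by rewrite imuE; have [] := fH imu.
have mul : mu <= l.
  by have [_ H _ _] := fH imu; rewrite imuE; apply: le_trans H (lle imu).
have l0 : 0 < l by exact: lt_le_trans mul.
have th2 : 0 < 1 + 2 * theta by rewrite ltr_wpDr // mulr_ge0.
have al : alpha * l * (1 + 2 * theta) < 1.
  by rewrite -mulrA -ltr_pdivlMr // mulr_gt0.
set r := sigma_max C in beta_le; set sA := sigma_max bA ^+ 2 in beta_le.
have r01 : 0 <= r < 1 by exact: sigma_max_lt1.
have /andP[r0 r1] := r01; have r1' : 0 < 1 - r by rewrite subr_gt0.
have sA0 : 0 <= sA by exact: sqr_ge0.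
have bs : beta * sA / (1 - r) <= mu.
  (* The bound on beta divides by [sA], so the case [sA] = 0, where the left side vanishes, is
     treated apart. *)
  have [->|sAN0] := eqVneq sA 0; first by rewrite mulr0 mul0r ltW.
  have sA1 : 0 < sA by rewrite lt_def sAN0.
  have ir : 0 < 1 / (1 - r) by rewrite divr_gt0.
  move: beta_le; rewrite ler_pdivlMr; last by rewrite mulr_gt0 // ltr_wpDr.
  apply: le_trans; by rewrite -mulrA ler_pM2l // ler_pM2l // div1r lerDl.
set sB := sigma_max B ^+ 2 in gamma_lt delta *; set eta := eta_min E in gamma_lt delta *.
move: gamma_lt; rewrite lt_min => /andP[c1 cE].
(* Division by zero yields 0, so [sB] = 0 would turn the bound on gamma into gamma < 0. *)
have sBN0 : sB != 0.
  apply: contraTneq cE => ->; rewrite invr0 mulr0 -leNgt; exact: ltW.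
have sB0 : 0 < sB by rewrite lt_def sBN0 sqr_ge0.
have sB1 : sB <= 1 by apply: sigma_max_le1; rewrite // Bsym.
have csB : gamma * sB < alpha * beta * eta by rewrite -ltr_pdivlMr.
have gs : 0 < 1 - gamma * sB by rewrite subr_gt0 (le_lt_trans _ c1) // ger_pMr.
set K := const_mx 1 : 'rV[R]_n.
have KB : K *m B = 0 by exact: ones_null.
(* A non-zero vector of zero sum: the image under B of a top singular vector, non-zero because [sB]
   is. *)
have [x0 [x0N0 Kx0]] : exists x0 : 'cV[R]_n, x0 != 0 /\ K *m x0 = 0.
  have [/singular_valuesP[z [zN0 _ Bz]] _] := sigma_maxP B n0.
  exists (B *m z); split; last by rewrite mulmxA KB mul0mx.
  apply/eqP => Bz0; move/eqP: Bz; rewrite Bz0 dotv0l eq_sym mulf_eq0 -/sB (negbTE sBN0) /=.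
  by rewrite gt_eqF // dotv_gt0.
have KBT : K *m B^T = 0 by rewrite Bsym.
have [smin0 sminle] := sigma_minP KBT (null_ones_eq0 n0 nullB) x0N0 Kx0.
set smin := sigma_min B ^+ 2 in delta *.
have smin1 : 0 < smin by exact: exprn_gt0.
set d1 := 1 - alpha * mu * _ in delta *; set d2 := _ / _ in delta *; set d3 := 1 - _ in delta *.
have amu0 : 0 < alpha * mu by rewrite mulr_gt0.
have al0 : 0 < alpha * l by rewrite mulr_gt0.
have amul : alpha * mu <= alpha * l by rewrite ler_pM2l.
have al1 : alpha * l <= alpha * l * (1 + 2 * theta).
  by rewrite ler_peMr ?(ltW al0) // lerDl mulr_ge0.
have d1_gt0 : 0 < d1.
  rewrite /d1 subr_gt0; apply: (@le_lt_trans _ _ (alpha * mu)); last first.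
    exact: le_lt_trans amul (le_lt_trans al1 al).
  by rewrite ler_piMr ?(ltW amu0) // gerBl (le_trans (ltW al0) al1).
have d1_lt1 : d1 < 1.
  by rewrite /d1 ltrBlDr ltrDl mulr_gt0 // subr_gt0.
have dd1 : d1 <= delta by rewrite /delta le_max lexx.
have dd2 : d2 <= delta by rewrite /delta !le_max lexx orbT.
have dd3 : d3 <= delta by rewrite /delta !le_max lexx !orbT.
have delta0 : 0 < delta by exact: lt_le_trans dd1.
have delta1 : delta < 1.
  rewrite /delta !gt_max d1_lt1 /= /d2 ltr_pdivrMr // mul1r ltrD2l ltrN2 csB /=.
  by rewrite /d3 ltrBlDr ltrDl mulr_gt0.
split; first by rewrite delta0.
have gsum0 z : esum_fun g z = 0%E by rewrite /esum_fun big1.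
have fquad v t := @sum_fun_quad R n d f l_ xs v t (fun i => let: And4 _ _ _ H := fH i in H).
have [ls [r0' [gls hxs hsub]]] : exists ls r0',
    [/\ gradient (sum_fun f) xs + (row_blocks A)^T *m ls = 0,
    h (row_blocks A *m xs) = r0'%:E &
    forall w, ((r0' + dotv ls (w - row_blocks A *m xs))%:E <= h w)%E].
  apply: exists_multiplier fquad hproper hconv Afree _ => z.
  by have := xsmin z; rewrite /objective !gsum0 !adde0.
set z := row_blocks A *m xs in hxs hsub.
have [Hb Hsub] := avg_conjugate_subgradient n0 hxs hsub.
(* Fixed point values of lambda and v: us - b is beta times the subgradient of the averaged
   conjugate at b, so b is the proximal point of us = D us. *)
pose b := stack n ls; pose us := b + (beta / n%:R) *: stack n z.
have nN0 : n%:R != 0 :> R by rewrite pnatr_eq0 -lt0n.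
have stack_null (M : 'M[R]_n) (w : 'cV[R]_p) : nullspace M = span_ones R n ->
    kron_id p M *m stack n w = 0.
  by move=> /nullspace_ones/kron_stack ->; rewrite scale0r.
have Dus : kron_id p D *m us = us.
  have D1 (w : 'cV[R]_p) : kron_id p D *m stack n w = stack n w.
    by rewrite (kron_stack _ (stochastic_ones Dst)) scale1r.
  by rewrite /us mulmxDr -scalemxAr !D1.
have Bus : kron_id p B *m us = 0.
  by rewrite /us mulmxDr -scalemxAr !stack_null // scaler0 addr0.
have Cb : kron_id p C *m b = 0 by rewrite stack_null.
have gb : gradient (sum_fun f) xs + bA^T *m b = 0.
  rewrite -gls; congr (_ + _); apply: submxcol_inj => i.
  by rewrite submxcol_diag_blocksT submxcol_stack submxcol_row_blocksT.
have [P PP] := consensus_inverse n0 Bsym nullB.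
(* The fixed point equation of the v-update is B ys = rhs. It is solvable because each slice of rhs
   sums to zero: the blocks A_i xs_i add up to z, and so do n copies of z / n. *)
pose rhs := beta *: (bA *m xs) - (us - b).
pose ys := kron_id p P *m rhs.
have Krhs q : K *m slice q rhs = 0.
  have Kbx : K *m slice q (bA *m xs) = (z q 0)%:M.
    rewrite ones_mul; congr (_%:M); rewrite /z row_blocks_mul summxE.
    by apply: eq_bigr => k _; rewrite mxE submxcol_diag_blocks.
  have K1 : K *m const_mx 1 = n%:R%:M.
    rewrite ones_mul; congr (_%:M); rewrite (eq_bigr (fun=> 1)) => [|k _]; last by rewrite mxE.
    by rewrite sumr_const card_ord.
  rewrite /rhs /us [b + _]addrC addrK sliceB !sliceZ slice_stack.
  rewrite mulmxBr -!scalemxAr Kbx K1 !scale_scalar_mx -raddfB /=.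
  by rewrite (_ : _ - _ = 0) ?raddf0 //; field.
have Kys q : K *m slice q ys = 0 by rewrite slice_kron; have [] := PP _ (Krhs q).
have Bys : kron_id p B *m ys = rhs.
  by apply: slice_inj => q; rewrite !slice_kron; have [] := PP _ (Krhs q).
(* Starting from 0, y only receives increments in the range of B, so its error keeps zero-sum
   slices; there the lower bound by [sigma_min B] is available. *)
have KY k q : K *m slice q (y k - ys) = 0.
  elim: k => [|k IH]; first by rewrite sliceB y0 slice0 sub0r mulmxN Kys oppr0.
  have [_ _ _ -> _] := alg k.
  by rewrite addrAC sliceD mulmxDr IH add0r sliceZ slice_kron -scalemxAr mulmxA KB mul0mx scaler0.
have BsymK : (kron_id p B)^T = kron_id p B by rewrite kron_tr Bsym.
have primal k : x k.+1 - xs = (x k - xs) - alpha *: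
    ((gradient (sum_fun f) (x k) - gradient (sum_fun f) xs) + bA^T *m (lam k - b)).
  have [/(prox_const0 a0 gsum0) -> _ _ _ _] := alg k.
  rewrite [RHS]addrAC; congr (_ - _ *: _ - _).
  by rewrite mulmxBr addrACA -opprD gb subr0.
pose wk k := (lam k - b) - kron_id p C *m (lam k - b) + beta *: (bA *m ((x k.+1 - xs) +
     theta *: ((x k.+1 - xs) - (x k - xs)))).
have dualv k : v k.+1 - us = wk k - kron_id p B *m (y k - ys).
  have [_ xh -> _ _] := alg k.
  rewrite mulmxBr Bys /rhs /wk mulmxBr Cb subr0.
  have -> : (x k.+1 - xs) + theta *: ((x k.+1 - xs) - (x k - xs)) = xhat k.+1 - xs.
    by rewrite xh opprB addrA subrK addrAC.
  rewrite mulmxBr scalerBr.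
  move: (kron_id p C *m lam k) (kron_id p B *m y k) (beta *: (bA *m xhat k.+1))
        (beta *: (bA *m xs)) => m1 m2 m3 m4.
  by apply/matrixP => i j; rewrite !mxE; ring.
have dualy k : y k.+1 - ys = (y k - ys) + gamma *: (kron_id p B *m (v k.+1 - us)).
  by have [_ _ _ -> _] := alg k; rewrite mulmxBr Bus subr0 addrAC.
have duallam k : dotv (lam k.+1 - b) (lam k.+1 - b) <= dotv (v k.+1 - us) (v k.+1 - us).
  have [_ _ _ _ pr] := alg k.
  apply: (@le_trans _ _ (dotv (kron_id p D *m v k.+1 - us) (kron_id p D *m v k.+1 - us))).
    apply: (prox_nonexpansive b0 (econvex_avg_conjugate hproper) Hb _ pr) => w.
    apply: le_trans (Hsub w); rewrite lee_fin lerD2l /us [b + _]addrC addrK dotvZl -/b.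
    rewrite mulrA le_eqVlt; apply/orP; left; apply/eqP; congr (_ * _).
    by field; rewrite nN0 gt_eqF.
  rewrite -{1 2}Dus -mulmxBr -[leRHS]mul1r.
  by apply: kron_sqr_le => w; exact: doubly_stochastic_contract.
pose kap := 1 - alpha * (beta * sA / (1 - r)) * (1 + theta).
(* The subtracted term is at most alpha l (1 + theta), hence below 1 by the bound on alpha. *)
have kap0 : 0 < kap.
  have q1 : alpha * (beta * sA / (1 - r)) * (1 + theta) <= alpha * l * (1 + theta).
    rewrite ler_pM2r ?ltr_wpDr // ler_pM2l //; exact: le_trans mul.
  rewrite /kap subr_gt0; apply: le_lt_trans q1 (le_lt_trans _ al).
  by rewrite ler_pM2l // lerD2l mulrDl mul1r lerDl.
have cpos : 0 < kap * (beta / alpha) by rewrite mulr_gt0 // divr_gt0.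
pose V k := kap * (beta / alpha) * dotv (x k - xs) (x k - xs)
  + (1 - gamma * sB) * dotv (lam k - b) (lam k - b)
  + gamma^-1 * dotv (y k - ys) (y k - ys).
apply: (@geometric_eqO _ _ V (kap * (beta / alpha))) => // k.
- exact: sqr_ge0.
- rewrite enorm_sqr /V -addrA lerDl addr_ge0 // mulr_ge0 ?dotv_ge0 ?(ltW gs) //.
  by rewrite invr_ge0 ltW.
rewrite /V dualy.
apply: (lyapunov_step (d1 := d1) (ae := alpha * beta * eta) (smin := smin)
  BsymK c0 gs (dualv k) _ _ (duallam k) _ _ dd1 dd2 dd3).
- by apply: kron_sqr_le => w; exact: sigma_max_bound.
- rewrite !dotv_slice mulr_sumr; apply: ler_sum => q _.
  by rewrite slice_kron; exact: sminle.
- have [mono coco] := sum_gradient_bounds (x k) xs (ltW mu0) fH mule lle.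
  have CL : dotv (kron_id p C *m (lam k - b)) (kron_id p C *m (lam k - b)) <=
      r * dotv (lam k - b) (kron_id p C *m (lam k - b)).
    by apply: kron_sqr_le_quad => w; exact: psd_sqr_le.
  have := primal_step a0 b0 mu0 l0 th0 al mul r01 sA0 bs CL (kron_psd _ Cpsd)
    (sigma_max_bound bA) mono coco (primal k) (erefl (wk k)) (erefl kap).
  move=> /le_trans; apply; rewrite -/E -/d1 -addrA lerD2l mulrBl mul1r lerD2l lerN2.
  rewrite -[alpha * beta * eta * _]mulrA ler_pM2l ?mulr_gt0 //; apply: eta_min_le.
  apply: pd_dual_operator => //; by rewrite invr_gt0 !mulr_gt0.
- by rewrite mulr_ge0 ?dotv_ge0 // ltW.
Qed.
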